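(* Let $d\geq3$ and $\mathsf q\geq3$ be integers. There exists a constant $c>0$ (depending only on $d$ and $\mathsf q$) such that for all $T,\epsilon$ with $0\leq T\leq c$ and $0\leq\epsilon\leq c$ and for all $N\geq1$, with $\mathbb P$-probability at least $1-e^{-c/T}-e^{-c/\epsilon^2}$, $$\mu^{1}_{T,\Lambda_N,\epsilon h}(\sigma_o=1)\;\geq\;1-e^{-c/T}-e^{-c/\epsilon^2},$$ where $\mu^{1}_{T,\Lambda_N,\epsilon h}$ is the Gibbs measure of the $\mathsf q$-state random field Potts model on $\Lambda_N\subset\mathbb Z^d$ with boundary condition $1$.
   Context: Lattice: on $\mathbb Z^d$, write $u\sim v$ if the $\ell_1$-distance of $u,v$ is $1$. For an integer $N\geq1$, $\Lambda_N=[-N,N]^d\cap\mathbb Z^d$; $o$ is the origin; $\Lambda_N^c=\mathbb Z^d\setminus\Lambda_N$. Disorder: $\{h_{k,v}:k\in\{1,\dots,\mathsf q\},v\in\mathbb Z^d\}$ are i.i.d. Gaussian random variables with mean $0$ and variance $1$; $\mathbb P$ denotes their law. Random field Potts model: for $\epsilon\geq0$, $k\in\{1,\dots,\mathsf q\}$ and $\sigma\in\{1,\dots,\mathsf q\}^{\Lambda_N}$, the Hamiltonian with boundary condition $k$ is $$H^{k,\Lambda_N,\epsilon h}(\sigma)=-\Big(\sum_{u\sim v,\ u,v\in\Lambda_N}\mathbf 1_{\sigma_u=\sigma_v}+\sum_{u\sim v,\ u\in\Lambda_N,\ v\in\Lambda_N^c}\mathbf 1_{\sigma_u=k}+\sum_{u\in\Lambda_N}\epsilon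 h_{\sigma_u,u}\Big),$$ where the sums over $u\sim v$ count each (unordered) nearest-neighbour edge once. The Gibbs measure at temperature $T$ is the (random) probability measure on $\{1,\dots,\mathsf q\}^{\Lambda_N}$ $$\mu^{k}_{T,\Lambda_N,\epsilon h}(\sigma)=\frac{e^{-\frac1T H^{k,\Lambda_N,\epsilon h}(\sigma)}}{\sum_{\sigma'\in\{1,\dots,\mathsf q\}^{\Lambda_N}}e^{-\frac1T H^{k,\Lambda_N,\epsilon h}(\sigma')}},$$ understood for $T=0$ as its limit as $T\downarrow0$, i.e. the uniform measure on the minimizers of $H^{k,\Lambda_N,\epsilon h}$. Conventions: $e^{-c/T}=0$ if $T=0$ and $e^{-c/\epsilon^2}=0$ if $\epsilon=0$. *)

(* Defs.v *)
From HB Require Import structures.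
From mathcomp Require Import all_boot all_order all_algebra finmap.
From mathcomp Require Import all_classical all_reals all_analysis.

Set Implicit Arguments.
Unset Strict Implicit.
Unset Printing Implicit Defensive.

Import Order.TTheory GRing.Theory Num.Theory.
Import numFieldNormedType.Exports.

Local Open Scope classical_set_scope.
Local Open Scope ring_scope.

Section Lattice.
Variable d : nat.

Definition adj (u v : 'rV[int]_d) : bool := \sum_(i < d) `|u 0 i - v 0 i| == 1.

Definition box_set (N : nat) : set 'rV[int]_d :=
  [set v : 'rV[int]_d | forall i, `|v 0 i| <= N%:Z].

(* [fset_set] is only meaningful on finite sets; see [finite_box_set]. *)
Definition box (N : nat) : {fset 'rV[int]_d} := fset_set (box_set N).

Lemma finite_box_set N : finite_set (box_set N).
Proof.
pose f (x : {ffun 'I_d -> 'I_(N.*2.+1)}) : 'rV[int]_d :=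
  \row_i ((x i : nat)%:Z - N%:Z).
apply: (@sub_finite_set _ _ (f @` setT)); last exact: finite_image.
move=> v vN; exists [ffun i => inord (absz (v 0 i + N%:Z))] => //.
apply/rowP => i; rewrite !mxE ffunE.
have := vN i; rewrite ler_norml => /andP[lo hi].
have ge0 : 0 <= v 0 i + N%:Z by rewrite -lerBlDr sub0r.
rewrite inordK; first by rewrite gez0_abs// addrK.
by rewrite ltnS -lez_nat gez0_abs// -addnn PoszD lerD2r.
Qed.

Lemma mem_boxP N v : reflect (box_set N v) (v \in box N).
Proof. by rewrite in_fset_set; [exact: asboolP|exact: finite_box_set]. Qed.

Lemma origin_in_box N : (0 : 'rV[int]_d) \in box N.
Proof. by apply/mem_boxP => i; rewrite mxE normr0. Qed.

Definition origin N : box N := [` origin_in_box N]%fset.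

(* Undirected edges, as two-element sets, so that each one is counted once. *)
Definition inner_edges N : {set {set box N}} :=
  [set e : {set box N} | [exists u : box N, exists v : box N,
     adj (fsval u) (fsval v) && (e == [set u; v])]]%SET.

Definition outer_neighbours N (u : box N) : set 'rV[int]_d :=
  [set v : 'rV[int]_d | adj (fsval u) v /\ v \notin box N].

Lemma finite_outer_neighbours N (u : box N) : finite_set (outer_neighbours u).
Proof.
apply: (@sub_finite_set _ _ (box_set N.+1)); last exact: finite_box_set.
move=> v [/eqP uv _] i.
have /mem_boxP uN := fsvalP u.
have uvi : `|fsval u 0 i - v 0 i| <= 1.
  by rewrite -uv (bigD1 i)//= lerDl sumr_ge0.
rewrite -[v 0 i](subKr (fsval u 0 i)) (le_trans (ler_normB _ _))//.
by rewrite [N.+1%:Z]intS addrC lerD// uN.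
Qed.

End Lattice.

Section Gibbs.
Variables (R : realType) (S : finType) (H : S -> R).

Definition minimizers : {set S} :=
  [set s | [forall s', H s <= H s']]%SET.

(* Mass function of the Gibbs measure of energy [H] at temperature [T]. *)
Definition gibbs_pmf (T : R) (s : S) : R :=
  if T == 0 then (s \in minimizers)%:R / #|minimizers|%:R
  else expR (- (T^-1 * H s)) / \sum_s' expR (- (T^-1 * H s')).

Definition gibbs (T : R) (A : {set S}) : R := \sum_(s in A) gibbs_pmf T s.

(* At temperature 0 the definition is the limit from the right. *)
Lemma cvg_gibbs0 (A : {set S}) : gibbs T A @[T --> 0^'+] --> gibbs 0 A.
Proof.
have [S0|/card_gt0P[s0 _]] := posnP #|S|.
  have gE T : gibbs T A = 0.
    by apply: big1 => s _; have := fintype0 s S0.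
  by under eq_fun do rewrite gE; rewrite gE; exact: cvg_cst.
pose m := [arg min_(s < s0) H s]%O.
have mP s : H m <= H s by rewrite /m; case: arg_minP => // i _; exact.
have minE s : (s \in minimizers) = (H s == H m).
  rewrite inE; apply/forallP/eqP => [sm|-> //].
  by apply/eqP; rewrite eq_le mP sm.
pose g T s := expR (- (T^-1 * (H s - H m))).
have gcvg s : g T s @[T --> 0^'+] --> ((s \in minimizers)%:R : R).
  rewrite minE; have [Hs|Hs] := eqVneq (H s) (H m).
    by under eq_fun do rewrite /g Hs subrr mulr0 oppr0 expR0; exact: cvg_cst.
  have Hsm : 0 < H s - H m by rewrite subr_gt0 lt_neqAle eq_sym Hs mP.
  apply/cvgrPdist_lt => /= e e0.
  near=> T; have T0 : 0 < T by near: T; exact: nbhs_right_gt.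
  rewrite sub0r normrN ger0_norm ?expR_ge0// /g expRN.
  rewrite -[e]invrK ltf_pV2 ?posrE ?expR_gt0 ?invr_gt0//.
  apply: (@lt_le_trans _ _ (1 + T^-1 * (H s - H m))); last exact: expR_ge1Dx.
  rewrite ltr_wpDl// mulrC ltr_pdivlMr//; near: T.
  have : 0 < e * (H s - H m) by exact: mulr_gt0.
  by move=> /nbhs_right_lt; apply: filterS => T; rewrite ltr_pdivrMl.
have gsum : \sum_s g T s @[T --> 0^'+] --> (#|minimizers|%:R : R).
  have -> : #|minimizers|%:R = \sum_s (s \in minimizers)%:R :> R.
    by rewrite -sum1_card natr_sum big_mkcond; apply: eq_bigr => s _; case: ifP.
  apply: cvg_big => [|s _]; [exact: add_continuous|exact: gcvg].
have m0 : #|minimizers|%:R != 0 :> R.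
  by rewrite pnatr_eq0 -lt0n; apply/card_gt0P; exists m; rewrite minE.
apply: cvg_big => [|s _]; first exact: add_continuous.
rewrite /gibbs_pmf eqxx.
apply: cvg_trans (cvgM (gcvg s) (cvgV m0 gsum)).
apply: near_eq_cvg; near=> T.
have T0 : T != 0 by rewrite gt_eqF//; near: T; exact: nbhs_right_gt.
rewrite /= (negbTE T0) /g.
have E s' : expR (- (T^-1 * (H s' - H m))) =
    expR (- (T^-1 * H s')) * expR (T^-1 * H m).
  by rewrite -expRD mulrBr opprB addrC.
under eq_bigr do rewrite E; rewrite E -mulr_suml invfM mulrACA divff ?mulr1//.
by rewrite gt_eqF// expR_gt0.
Unshelve. all: by end_near. Qed.

End Gibbs.

Section Potts.
Variables (R : realType) (d q : nat).

(* The colours 1, ..., q are encoded as 0, ..., q - 1. *)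
Definition color1 (hq : (2 < q)%N) : 'I_q := Ordinal (ltn_trans (isT : 0 < 2)%N hq).

Definition config N := {ffun box d N -> 'I_q}.

Definition hamiltonian (k : 'I_q) N (eps : R) (h : 'I_q -> 'rV[int]_d -> R)
    (s : config N) : R :=
  - (\sum_(e in inner_edges d N)
        [forall u in e, [forall v in e, s u == s v]]%:R
     + \sum_(u : box d N) \sum_(v \in outer_neighbours u) ((s u == k)%:R : R)
     + \sum_(u : box d N) eps * h (s u) (fsval u)).

Definition potts_gibbs (k : 'I_q) (T : R) N (eps : R)
    (h : 'I_q -> 'rV[int]_d -> R) : {set config N} -> R :=
  gibbs (hamiltonian k eps h) T.

End Potts.

Section Disorder.
Context {dsp : measure_display} {Om : measurableType dsp} {R : realType}
  (P : probability Om R).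

Definition mutually_independent (I : choiceType) (X : I -> {RV P >-> R}) : Prop :=
  forall (J : {fset I}) (B : I -> set R), (forall i, measurable (B i)) ->
    fine (P (\bigcap_(i in [set` J]) (X i @^-1` B i))) =
    \prod_(i <- J) fine (P (X i @^-1` B i)).

Definition iid_standard_gaussian (I : choiceType) (X : I -> {RV P >-> R}) : Prop :=
  mutually_independent X /\
  forall i (B : set R), measurable B -> distribution P (X i) B = normal_prob 0 1 B.

End Disorder.

(* e^{-a/x}, with the convention that it vanishes at x = 0 (whereas the
   library's [a / 0] is [0]). *)
Definition exp_neg_div {R : realType} (a x : R) : R :=
  if x == 0 then 0 else expR (- (a / x)).

(* Main.v *)
(* A Peierls argument for the field as well as for the configuration.  If the
   spin at the origin differs from the boundary colour [a], some finite set [A]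
   containing the origin, with a connected boundary, has exactly one endpoint of
   each of its boundary edges coloured [a].  Exchanging [a] and a suitable colour
   [k] on [A], both in the configuration and in the field, lowers the energy by
   at least [perimeter A / q].  The usual estimate goes through provided the
   exchange of the field multiplies the partition function by at most
   [exp (perimeter A / (2 q T))], simultaneously for all contours.

   Write [F B] for the free energy of the field exchanged on [B].  The law of the
   field is invariant under exchanges, and exchanging on the symmetric difference
   of [B] and [B'] negates [F B - F B'].  Averaging over all partial exchanges thus
   bounds the exponential moment of [F B - F B'] by that of a linear function of
   the field: it is sub-Gaussian with variance of order [eps^2 #|B xor B'|].

   A union bound over all contours would fail, so the contours are chained over
   the scales [l = 16^n].  Replacing [A] by its trace at the corners of a well
   chosen translate of the grid of mesh [l] changes at most [4 l m] sites, where
   [m] is the perimeter, and this trace flips along at most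
   [2 m / l^2] edges of the grid in a fixed direction, because [d >= 3].  These flips
   determine the trace by parity, and a walk along the boundary of [A] with steps of
   length of order [l^2] encodes them in a word of length [6 m / l^2].  The cost
   in entropy is therefore of order [m n / 256^n], against a Gaussian exponent of
   order [m / (eps^2 64^n)].

   The case [T = 0] follows by letting [T] tend to 0. *)

Require Import Defs.
From HB Require Import structures.
From mathcomp Require Import all_boot all_order all_algebra finmap.
From mathcomp Require Import all_classical all_reals all_analysis.
From mathcomp Require Import measurable_realfun perm zify ring lra.
Import Order.TTheory GRing.Theory Num.Theory.
Import numFieldNormedType.Exports.
Local Open Scope classical_set_scope.
Local Open Scope ring_scope.

Set Implicit Arguments.
Unset Strict Implicit.
Unset Printing Implicit Defensive.

(** * Flips of a finite set *)

Section Exits.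
Context {d : nat}.
Implicit Types (A : {fset 'rV[int]_d}) (u v x : 'rV[int]_d).

Definition unitv (i : 'I_d) : 'rV[int]_d := delta_mx 0 i.

Definition exits A v : nat := count (fun x => x + v \notin A) A.

(** The number of boundary edges of [A], each counted from its endpoint in [A]. *)
Definition perimeter A : nat :=
  (\sum_(i < d) (exits A (unitv i) + exits A (- unitv i)))%N.

Lemma unitvE i j : unitv i 0 j = (j == i)%:R.
Proof. by rewrite mxE eqxx. Qed.

Lemma unitv_neq0 i : unitv i != 0.
Proof. by apply/eqP => /rowP/(_ i); rewrite unitvE mxE eqxx. Qed.

Lemma exits0 A : exits A 0 = 0%N.
Proof. by apply/eqP; rewrite eqn0Ngt -has_count; apply/hasPn => x; rewrite addr0 negbK. Qed.

(** A point that leaves [A] along [u + v] either leaves it along [u], or is moved by [u] to a point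
    of [A] that leaves along [v]. *)
Lemma exitsD A u v : (exits A (u + v) <= exits A u + exits A v)%N.
Proof.
rewrite {1}/exits -size_filter.
set s := [seq x <- A | _].
rewrite -(count_predC (fun x => x + u \notin A) s) leq_add//.
  by rewrite count_filter; apply: sub_count => x /= /andP[].
rewrite /exits -!size_filter -(size_map (+%R^~ u)); apply: uniq_leq_size.
  rewrite map_inj_uniq; last by move=> ? ? /addIr.
  by rewrite !filter_uniq// fset_uniq.
move=> _ /mapP[x + ->]; rewrite !mem_filter/= negbK => /andP[xu] /andP[xuv xA].
by rewrite -addrA xuv.
Qed.

Lemma exits_sum A (I : Type) (r : seq I) (F : I -> 'rV[int]_d) :
  (exits A (\sum_(i <- r) F i) <= \sum_(i <- r) exits A (F i))%N.
Proof.
elim: r => [|i r IH]; first by rewrite !big_nil exits0.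
by rewrite !big_cons (leq_trans (exitsD _ _ _))// leq_add2l.
Qed.

Lemma exitsMn A v n : (exits A (v *+ n) <= n * exits A v)%N.
Proof.
elim: n => [|n IH]; first by rewrite mulr0n exits0.
by rewrite mulrS (leq_trans (exitsD _ _ _))// mulSn leq_add2l.
Qed.

Lemma exits_bounded A v (L : nat) : (forall i, `|v 0 i| <= L%:Z) ->
  (exits A v <= L * perimeter A)%N.
Proof.
move=> vL; rewrite [v]row_sum_delta; apply: (leq_trans (exits_sum _ _ _)).
rewrite /perimeter big_distrr leq_sum//= => i _.
have := vL i; case: (v 0 i) => n.
  move=> nL; rewrite -[Posz n]natz scaler_nat; apply: (leq_trans (exitsMn _ _ _)).
  by apply: leq_mul; [lia|exact: leq_addr].
move=> nL; rewrite NegzE scaleNr -[Posz n.+1]natz scaler_nat -mulNrn.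
apply: (leq_trans (exitsMn _ _ _)); by apply: leq_mul; [lia|exact: leq_addl].
Qed.

(** A flip at a point of [A] is an exit along [v]; a flip at a point [x] outside is an exit of
    [x + v] along [- v]. *)
Lemma count_flip_le A v (U : seq 'rV[int]_d) : uniq U ->
  (count (fun x => (x \in A) != (x + v \in A)%R) U <= exits A v + exits A (- v))%N.
Proof.
move=> uU; rewrite -size_filter -(count_predC (mem A)) leq_add//.
  rewrite /exits -!size_filter; apply: uniq_leq_size; rewrite ?filter_uniq//.
  by move=> x; rewrite !mem_filter/= => /andP[->] /andP[/= + _]; case: (_ \in _).
rewrite /exits -!size_filter -(size_map (+%R^~ v)); apply: uniq_leq_size.
  rewrite map_inj_uniq; last by move=> ? ? /addIr.
  by rewrite !filter_uniq.
move=> _ /mapP[x + ->]; rewrite !mem_filter/= addrK => /andP[xA /andP[+ _]].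
by rewrite xA; move: xA; case: (x \in A) => //= _; case: (_ \in A).
Qed.

Lemma exit_point A x v : v != 0 -> x \in A ->
  exists n, x + v *+ n.+1 \notin A /\ forall k, (k <= n)%N -> x + v *+ k \in A.
Proof.
move=> v0 xA.
have [n nA] : exists n, x + v *+ n \notin A.
  apply/not_existsP => allA.
  have : (size (mkseq (fun n => x + v *+ n)%R (size A).+1) <= size A)%N.
    apply: uniq_leq_size.
      apply/mkseq_uniqP => i j _ _ /addrI /eqP.
      wlog ij : i j / (i <= j)%N => [hw|].
        by case/orP: (leq_total i j) => ij E; [|apply/esym]; apply: hw => //; rewrite eq_sym.
      rewrite -(subnK ij) mulrnDr eq_sym -subr_eq0 addrK => /eqP/rowP v0'.
      case: (posnP (j - i)) => [->//|ji0].
      case/eqP: v0; apply/rowP => k; have := v0' k; rewrite mulmxnE !mxE.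
      by move/eqP; rewrite mulrn_eq0 gtn_eqF//= => /eqP.
    by move=> _ /mapP[k _ ->]; apply/negPn/negP; exact: allA.
  by rewrite size_mkseq ltnn.
case: (ex_minnP (ex_intro (fun n => x + v *+ n \notin A) n nA)) => -[|m] mA mmin.
  by move: mA; rewrite addr0 xA.
exists m; split => // k km; apply/negPn/negP => /mmin; lia.
Qed.

(** From each point [unitv i *+ k] with [k <= n], go along [j] until [A] is left: this gives
    distinct exits in direction [j]. The start of the walk along the boundary of a contour can thus
    be placed on the axis [i], at one of [perimeter A + 1] positions. *)
Lemma exit_axis A (i j : 'I_d) : i != j -> 0 \in A ->
  exists n, [/\ (n <= perimeter A)%N, unitv i *+ n \in A & unitv i *+ n.+1 \notin A].
Proof.
move=> ij A0; have [n] := exit_point (unitv_neq0 i) A0.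
rewrite add0r => -[nA inA]; exists n; split=> //; last first.
  by have := inA n (leqnn n); rewrite add0r.
have /(_ _)/cid-/all_sig[f fP] : forall k : 'I_n.+1, exists m,
    unitv i *+ k + unitv j *+ m \in A /\ unitv i *+ k + unitv j *+ m.+1 \notin A.
  move=> k; have := inA k; rewrite -ltnS ltn_ord add0r => /(_ isT) kA.
  have [m [mA inm]] := exit_point (unitv_neq0 j) kA.
  by exists m; split => //; exact: inm.
apply: (@leq_trans (exits A (unitv j))); last first.
  by rewrite /perimeter (bigD1 j)//= -addnA leq_addr.
apply: ltnW; rewrite -[X in (X <= _)%N](size_enum_ord n.+1).
rewrite -(size_map (fun k : 'I_n.+1 => unitv i *+ k + unitv j *+ f k)).
rewrite /exits -size_filter; apply: uniq_leq_size.
  rewrite map_inj_uniq ?enum_uniq// => k k' /rowP/(_ i).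
  rewrite !mxE !mulmxnE !mxE !eqxx (negbTE ij) /= => E; apply/val_inj; move: E.
  by rewrite !mul0rn !addr0 !natz => -[].
move=> _ /mapP[k _ ->]; rewrite mem_filter -addrA -mulrSr.
by have [-> ->] := fP k.
Qed.

End Exits.

(** * Recovering a finite set from its flips along a direction *)

Section Rays.
Context {d : nat}.
Implicit Types (D : seq 'rV[int]_d) (v p y : 'rV[int]_d).

Definition onray v p y : bool := `[< exists n, y = p + v *+ n >].

(** By [ray_unique], this parity recovers a boolean function that vanishes far along [v] from the
    set [D] of its flips. *)
Definition ray v D p : bool := odd (count (onray v p) D).

Lemma mulrn_row_eq0 v n : v != 0 -> v *+ n = 0 -> n = 0%N.
Proof.
move=> v0 /rowP vn0; case: (posnP n) => // n0.
case/eqP: v0; apply/rowP => k; have := vn0 k; rewrite mulmxnE !mxE.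
by move/eqP; rewrite mulrn_eq0 gtn_eqF//= => /eqP.
Qed.

Lemma onray_step v p y : v != 0 ->
  onray v p y = (y == p) (+) onray v (p + v) y.
Proof.
move=> v0; have [->|yp] /= := eqVneq y p.
  have -> : onray v p p by apply/asboolP; exists 0%N; rewrite mulr0n addr0.
  apply/esym/negP => /asboolP[n /eqP].
  rewrite -addrA -mulrS -subr_eq0 opprD addNKr oppr_eq0 => /eqP.
  by move/(mulrn_row_eq0 v0).
apply/asboolP/asboolP => -[[|n] E].
- by move: yp; rewrite E mulr0n addr0 eqxx.
- by exists n; rewrite -addrA -mulrS.
- by exists 1%N; rewrite E mulr0n addr0.
- by exists n.+2; rewrite E -addrA -mulrS.
Qed.

Lemma ray_step v D p : v != 0 -> uniq D ->
  ray v D p = (p \in D) (+) ray v D (p + v).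
Proof.
move=> v0 uD; rewrite /ray; have := count_uniq_mem p uD; rewrite -[X in X (+) _]oddb => <-.
have -> : count (onray v p) D = count (fun y => (y == p) (+) onray v (p + v) y) D.
  by apply: eq_count => y; exact: onray_step.
elim: D {uD} => //= y D IH; rewrite !oddD IH.
by rewrite !oddb addbACA.
Qed.

Lemma ray_far v D p : v != 0 -> exists n, forall k, (n <= k)%N ->
  {in D, forall y, ~~ onray v (p + v *+ k) y}.
Proof.
move=> v0; elim: D => [|y D [n nP]]; first by exists 0%N.
have [[m ym]|ny] := pselect (exists m, y = p + v *+ m); last first.
  exists n => k nk z; rewrite inE => /orP[/eqP->|zD]; last exact: nP.
  apply/negP => /asboolP[m E]; apply: ny; exists (k + m)%N.
  by rewrite mulrnDr addrA.
exists (maxn n m.+1) => k; rewrite geq_max => /andP[nk mk] z.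
rewrite inE => /orP[/eqP->|zD]; last exact: nP.
apply/negP => /asboolP[j /eqP]; rewrite ym -(subnK mk).
rewrite -addrA -mulrnDr (inj_eq (addrI _)) -subr_eq0 -opprB oppr_eq0.
rewrite (_ : (k - m.+1 + m.+1 + j)%N = ((k - m.+1 + j).+1 + m)%N); last by lia.
by rewrite mulrnDr addrK => /eqP/(mulrn_row_eq0 v0).
Qed.

Lemma ray_far0 v D p : v != 0 -> exists n, forall k, (n <= k)%N ->
  ray v D (p + v *+ k) = false.
Proof.
move=> v0; have [n nP] := ray_far D p v0; exists n => k /nP kP.
rewrite /ray (eq_in_count (a2 := pred0)) ?count_pred0// => y /kP.
by move/negbTE.
Qed.

(** Along the line, [f] and [ray] flip at the same places, so their sum modulo 2 is constant; both
    are false far away. *)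
Lemma ray_unique v D p (f : 'rV[int]_d -> bool) : v != 0 -> uniq D ->
  (forall n, (f (p + v *+ n) != f (p + v *+ n.+1)) = (p + v *+ n \in D)) ->
  (exists n, forall k, (n <= k)%N -> f (p + v *+ k) = false) ->
  f p = ray v D p.
Proof.
move=> v0 uD fD [n1 far1]; have [n2 far2] := ray_far0 D p v0.
pose g n := f (p + v *+ n) (+) ray v D (p + v *+ n).
have gS n : g n = g n.+1.
  rewrite /g (ray_step _ v0 uD) -fD -addrA -mulrSr.
  by case: (f _); case: (f _); case: (ray _ _ _).
have g0 n : g 0%N = g n by elim: n => // n ->.
have : g 0%N = false.
  by rewrite (g0 (maxn n1 n2)) /g far1 ?leq_maxl// far2 ?leq_maxr.
by rewrite /g mulr0n addr0; case: (f p); case: (ray _ _ _).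
Qed.

End Rays.

(** * Translates of a grid *)

Section Grid.
Context {d l : nat}.
Implicit Types (A : {fset 'rV[int]_d}) (x : 'rV[int]_d).
Let Z := {ffun 'I_d -> 'I_l.+1}.

Definition offset (z : Z) : 'rV[int]_d := \row_i (z i : nat)%:Z.

Definition residue (z : Z) x : Z :=
  [ffun i => inord `|((x 0%R i - (z i : nat)%:Z)%R %% l.+1%:Z)%Z|%N].

(** The lowest corner of the cell containing [x] in the translate by [z] of the grid of mesh
    [l.+1]. *)
Definition corner z x : 'rV[int]_d := x - offset (residue z x).

Lemma residueE z x i :
  (residue z x i : nat)%:Z = ((x 0%R i - (z i : nat)%:Z)%R %% l.+1%:Z)%Z.
Proof.
have r0 : 0 <= ((x 0%R i - (z i : nat)%:Z)%R %% l.+1%:Z)%Z by exact: modz_ge0.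
rewrite ffunE inordK ?gez0_abs// -ltz_nat gez0_abs//.
by rewrite ltz_pmod.
Qed.

(** Lets averages over the translates be computed as averages over the offset of [x] from its
    corner, each offset occurring once. *)
Lemma residue_inj x : injective (residue ^~ x).
Proof.
move=> z z' E; apply/ffunP => i; apply/val_inj => /=.
have := residueE z x i; have := residueE z' x i; rewrite E => -> /eqP.
rewrite eqz_modDl => /eqP E'.
have : ((z i : nat) == z' i %[mod l.+1])%Z.
  by rewrite -[X in (X == _ %[mod _])%Z]opprK -[X in (_ == X %[mod _])%Z]opprK; apply/eqP; rewrite -modzNm -E' modzNm.
rewrite !modz_small ?ltz_nat ?ltn_ord ?lez_nat//.
by move/eqP => -[].
Qed.

Lemma corner_corner z x : corner z (corner z x) = corner z x.
Proof.
apply/rowP => i; rewrite /corner !mxE !residueE !mxE !residueE.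
set a := x 0 i; set b := (z i : nat)%:Z.
rewrite [X in _ - X](_ : _ = 0) ?subr0//; apply/eqP.
rewrite addrAC; rewrite {1}(divz_eq (a - b) l.+1) addrK.
by rewrite modzMl.
Qed.

Lemma cornerDM z x v n : corner z (x + v *+ (l.+1 * n)) = corner z x + v *+ (l.+1 * n).
Proof.
rewrite /corner addrAC; congr (_ - _ + _); apply/rowP => i.
rewrite !mxE !residueE mxE mulmxnE addrAC -mulr_natr natz PoszM mulrCA mulrC.
by rewrite addrC modzMDl.
Qed.

Lemma offset_le z i : `|offset z 0 i| <= l%:Z.
Proof. by rewrite mxE ger0_norm// lez_nat -ltnS. Qed.

(** For each [x] the sum over translates is a sum over offsets, by [residue_inj]. Subtracting a
    fixed offset, whose coordinates are at most [l], flips at most [2 * l * perimeter A] points. *)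
Lemma sum_flip_corner A (U : seq 'rV[int]_d) : uniq U ->
  (\sum_(z : Z) count (fun x => (x \in A) != (corner z x \in A)) U
    <= #|{: Z}| * (2 * l * perimeter A))%N.
Proof.
move=> uU; rewrite (eq_bigr (fun z : Z =>
  \sum_(x <- U) ((x \in A) != (corner z x \in A)))%N); last first.
  by move=> z _; rewrite -sum1_count big_mkcond; apply: eq_bigr => x _; case: (_ != _).
rewrite exchange_big/=.
rewrite (eq_bigr (fun x => \sum_(z : Z) ((x \in A) != ((x - offset z)%R \in A)))%N);
  last first.
  by move=> x _; rewrite [RHS](reindex_inj (@residue_inj x)).
rewrite exchange_big/= -sum_nat_const leq_sum// => z _.
rewrite (_ : (\sum_(_ <- _) _)%N =
  count (fun x => (x \in A) != (x + (- offset z) \in A)) U :> nat); last first.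
  by rewrite -sum1_count [RHS]big_mkcond; apply: eq_bigr => x _; case: (_ != _).
apply: (leq_trans (count_flip_le _ _ uU)); rewrite opprK -mulnA mul2n -addnn.
by rewrite leq_add//; apply: exits_bounded => i; [rewrite mxE normrN|]; exact: offset_le.
Qed.

Definition jumps A v : seq 'rV[int]_d :=
  undup [seq x <- A ++ [seq y - v | y <- A] | (x \in A) != (x + v \in A)].

Lemma mem_jumps A v x : (x \in jumps A v) = ((x \in A) != (x + v \in A)).
Proof.
rewrite mem_undup mem_filter mem_cat; apply: andb_idr.
have [//|xA] := boolP (x \in A); rewrite orFb => xv.
by apply/mapP; exists (x + v); rewrite ?addrK//; move: xv; case: (_ \in _).
Qed.

Lemma size_jumps A v : (size (jumps A v) <= exits A v + exits A (- v))%N.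
Proof.
rewrite -(count_predT (jumps A v)).
rewrite (eq_in_count (a2 := fun x => (x \in A) != (x + v \in A))).
  by apply: count_flip_le; exact: undup_uniq.
by move=> x; rewrite mem_jumps => ->.
Qed.

(** A point is a corner of at most one translate, so the translates share the jumps of [A] among
    them. *)
Lemma sum_grid_jumps A v :
  (\sum_(z : Z) count (fun x => corner z x == x) (jumps A v)
    <= exits A v + exits A (- v))%N.
Proof.
apply: leq_trans (size_jumps A v).
rewrite (eq_bigr (fun z : Z =>
  \sum_(x <- jumps A v) (corner z x == x))%N); last first.
  by move=> z _; rewrite -sum1_count big_mkcond; apply: eq_bigr => x _; case: (_ == _).
rewrite exchange_big/= -sum1_size leq_sum// => x _.
rewrite (_ : (\sum_(z in Z) _)%N = #|[pred z : Z | corner z x == x]|); last first.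
  by rewrite -sum1_card [RHS]big_mkcond; apply: eq_bigr => z _; rewrite inE; case: (_ == _).
apply/card_le1_eqP => z z'; rewrite !inE => /eqP zx /eqP z'x.
apply: (@residue_inj x); apply/ffunP => i; apply/val_inj => /=.
have off0 (w : Z) : corner w x = x -> (residue w x i : nat) = 0%N.
  by move/rowP/(_ i); rewrite /corner !mxE => /eqP; rewrite subr_eq addrC -subr_eq subrr eq_sym => /eqP -[].
by rewrite !off0.
Qed.

End Grid.

(** By Markov's inequality, each of the two bounds fails on fewer than half of the points of [Z]. *)
Lemma markov2 (Z : finType) (f1 f2 : Z -> nat) a b : (0 < #|Z|)%N ->
  (\sum_z f1 z <= #|Z| * a)%N -> (\sum_z f2 z <= #|Z| * b)%N ->
  exists z, (f1 z <= 2 * a)%N /\ (f2 z <= 2 * b)%N.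
Proof.
move=> Z0 s1 s2.
have half (f : Z -> nat) c : (\sum_z f z <= #|Z| * c)%N ->
    (2 * #|[pred z | 2 * c < f z]%N| < #|Z|)%N.
  move=> s; have : (#|[pred z | 2 * c < f z]%N| * (2 * c).+1 <= #|Z| * c)%N.
    apply: leq_trans s; rewrite -sum_nat_const.
    rewrite [leqRHS](bigID (fun z => 2 * c < f z)%N)/=.
    by apply: leq_trans (leq_addr _ _); rewrite leq_sum.
  nia.
have := half _ _ s1; have := half _ _ s2.
set P2 := [pred z | _]; set P1 := [pred z | _] => h2 h1.
have : (#|predU P1 P2| < #|Z|)%N.
  by apply: (@leq_ltn_trans (#|P1| + #|P2|)); [rewrite -cardUI leq_addr|lia].
rewrite -(cardC (predU P1 P2)) -[X in (X < _)%N]addn0 ltn_add2l => /card_gt0P[z].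
by rewrite !inE negb_or -!leqNgt => /andP[? ?]; exists z.
Qed.

(** * Coarse graining *)

Section Walks.
Context {d : nat}.
Implicit Types (x y s u : 'rV[int]_d) (w V D : seq 'rV[int]_d) (r : nat).

Definition within r x y : bool := [forall i, `|x 0 i - y 0 i| <= r%:Z].

Lemma withinP r x y : reflect (forall i, `|x 0 i - y 0 i| <= r%:Z) (within r x y).
Proof. exact: forallP. Qed.

Lemma within_sym r x y : within r x y = within r y x.
Proof. by apply/eq_forallb => i; rewrite distrC. Qed.

Lemma within_refl r x : within r x x.
Proof. by apply/withinP => i; rewrite subrr normr0. Qed.

Lemma within_trans r r' x y z : within r x y -> within r' y z -> within (r + r') x z.
Proof.
move=> /withinP xy /withinP yz; apply/withinP => i.
by rewrite (le_trans (ler_distD (y 0 i) _ _))// PoszD lerD.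
Qed.

Lemma within_le r r' x y : (r <= r')%N -> within r x y -> within r' x y.
Proof.
move=> rr' /withinP xy; apply/withinP => i; by rewrite (le_trans (xy i)).
Qed.

(** Connectedness for the relation of being at sup-distance at most 1, stated as an induction
    principle. *)
Definition connected1 V := forall W : pred 'rV[int]_d,
  (exists2 x, x \in V & W x) ->
  (forall x y, x \in V -> y \in V -> within 1 x y -> W x -> W y) ->
  forall y, y \in V -> W y.

(** A visit to [v] is replaced by [v], [u], [v]. The last inclusion leaves out the start [s],
    because words record only points reached by a step. *)
Lemma insert_detour r s w v u : path (within r) s w -> v \in s :: w ->
  within r v u -> exists w', [/\ path (within r) s w',
    size w' = (size w).+2, {subset u :: s :: w <= s :: w'},
    {subset s :: w' <= u :: s :: w} & {subset u :: w <= w'}].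
Proof.
move=> pw vw vu; have uv : within r u v by rewrite within_sym.
move: vw pw; rewrite inE => /orP[/eqP E pw|/splitPr[w1 w2]].
  rewrite -{s}E in pw *; exists (u :: v :: w); split=> //=; first by rewrite vu uv.
  - by move=> x; rewrite !inE => /or3P[] ->; rewrite ?orbT.
  - by move=> x; rewrite !inE => /or4P[] ->; rewrite ?orbT.
  - by move=> x; rewrite !inE => /orP[] ->; rewrite ?orbT.
rewrite cat_path/= => /and3P[p1 lv p2]; exists (w1 ++ v :: u :: v :: w2); split.
- by rewrite cat_path/= p1 lv vu uv.
- by rewrite !size_cat/= !addnS.
- move=> x; rewrite !(inE, mem_cat) => /or3P[->|->|/orP[->|/orP[]->]];
    by rewrite ?orbT.
- by move=> x; rewrite !(inE, mem_cat) => /orP[->|/orP[->|/or4P[]->]];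
    rewrite ?orbT.
- by move=> x; rewrite !(inE, mem_cat) => /orP[->|/orP[->|/orP[]->]];
    rewrite ?orbT.
Qed.

(** As long as the walk misses a point of [V], connectedness provides a missed point next to a
    visited one, and a detour to it costs two steps. The length therefore stays at most twice the
    number of visited points. *)
Lemma covering_walk V s : connected1 V -> s \in V ->
  exists w, [/\ path (within 1) s w, {subset V <= s :: w} &
    (size w <= 2 * size V)%N].
Proof.
move=> cV sV.
have [w [pw wV szw [szV|Vw]]] : exists w, [/\ path (within 1) s w,
    {subset s :: w <= V}, (size w <= 2 * size (undup (s :: w)))%N &
    (size V < size (undup (s :: w)))%N \/ {subset V <= s :: w}].
- elim: (size V).+1 => [|k [w [pw wV szw [kw|Vw]]]].
  + by exists [::]; split=> //=; [move=> x; rewrite inE => /eqP->|left].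
  + have [Vw|/allPn[y yV yw]] := boolP (all (mem (s :: w)) V).
      by exists w; split=> //; right; exact/allP.
    have : ~ forall x y, x \in V -> y \in V -> within 1 x y ->
        x \in s :: w -> y \in s :: w.
      move=> cl; case/negP: yw; apply: (cV (mem (s :: w))) => //.
      by exists s => //=; exact: mem_head.
    move=> /existsNP[v] /existsNP[u] /not_implyP[vV] /not_implyP[uV].
    move=> /not_implyP[vu] /not_implyP[vw /negP uw].
    have [w' [pw' sz' sub1 sub2 _]] := insert_detour pw vw vu.
    have szu : (size (undup (s :: w)) < size (undup (s :: w')))%N.
      apply: (@uniq_leq_size _ (u :: undup (s :: w))).
        by rewrite cons_uniq mem_undup uw undup_uniq.
      by move=> x; rewrite mem_undup inE mem_undup => h; apply: sub1; rewrite inE.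
    exists w'; split => //.
    * by move=> x /sub2; rewrite inE => /orP[/eqP->//|/wV].
    * by rewrite sz'; lia.
    * by left; rewrite (leq_ltn_trans kw).
  + by exists w; split=> //; right.
- suff : (size (undup (s :: w)) <= size V)%N by rewrite leqNgt szV.
  by apply: uniq_leq_size (undup_uniq _) _ => x; rewrite mem_undup => /wV.
- exists w; split=> //; rewrite (leq_trans szw)// leq_mul//.
  by apply: uniq_leq_size (undup_uniq _) _ => x; rewrite mem_undup => /wV.
Qed.

Lemma walk_within s w : path (within 1) s w ->
  {in s :: w, forall x, within (size w) s x}.
Proof.
elim: w s => [|y w IH] s /=.
  by move=> _ x; rewrite inE => /eqP->; exact: within_refl.
move=> /andP[sy pw] x; rewrite inE => /orP[/eqP->|xw]; first exact: within_refl.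
by rewrite -add1n; apply: within_trans sy _; exact: IH.
Qed.

(** Every [r]-th point of the walk is kept. *)
Lemma subsample r s w : (0 < r)%N -> path (within 1) s w ->
  exists w', [/\ path (within r) s w', (size w' <= size w %/ r)%N &
    forall x, x \in s :: w -> exists2 y, y \in s :: w' & within r y x].
Proof.
move=> r0; have [n] := ubnP (size w); elim: n s w => // n IH s w szw pw.
have [wr|rw] := ltnP (size w) r.
  exists [::]; split=> // x xw; exists s; first exact: mem_head.
  by apply: within_le (walk_within pw xw); exact: ltnW.
move: pw; rewrite -{1}(cat_take_drop r w) cat_path => /andP[p1 p2].
have sz1 : size (take r w) = r by rewrite size_takel.
have [|w' [pw' szw' cov]] := IH _ _ _ p2; first by rewrite size_drop; lia.
have near1 x : x \in s :: take r w -> within r s x.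
  by move=> xw; rewrite -[r in within r]sz1; exact: walk_within.
exists (last s (take r w) :: w'); split=> /=.
- by rewrite pw' andbT near1// mem_last.
- move: szw'; rewrite size_drop => szw'; rewrite -(subnK rw) divnDr ?dvdnn//.
  by rewrite divnn r0 addn1 ltnS.
- move=> x; rewrite inE => /orP[/eqP->|].
    by exists s; rewrite ?mem_head ?within_refl.
  rewrite -{1}(cat_take_drop r w) mem_cat => /orP[xt|xd].
    by exists s; rewrite ?mem_head ?near1// inE xt orbT.
  have [|y yw' yx] := cov x; first by rewrite inE xd orbT.
  by exists y => //; rewrite inE yw' orbT.
Qed.

Lemma insert_points r s w D : path (within r) s w ->
  (forall u, u \in D -> exists2 y, y \in s :: w & within r y u) ->
  exists w', [/\ path (within r) s w', size w' = (size w + 2 * size D)%N,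
    {subset s :: w <= s :: w'} & {subset D <= w'}].
Proof.
elim: D => [|u D IH] pw near; first by exists w; split=> //; rewrite muln0 addn0.
have [|w1 [pw1 sz1 sub1 Dw1]] := IH pw.
  by move=> v vD; apply: near; rewrite inE vD orbT.
have [y /sub1 yw yu] := near u (mem_head _ _).
have [w' [pw' sz' sub' _ sub2]] := insert_detour pw1 yw yu.
exists w'; split => //; first by rewrite sz' sz1/=; lia.
  by move=> x xw; apply: sub'; rewrite inE sub1 ?orbT.
move=> x; rewrite inE => /orP[/eqP->|xD]; apply: sub2; first exact: mem_head.
by rewrite inE Dw1 ?orbT.
Qed.

Definition letter r : finType := ({ffun 'I_d -> 'I_(r.*2.+1)} * bool)%type.

Definition shift r (a : {ffun 'I_d -> 'I_(r.*2.+1)}) : 'rV[int]_d :=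
  \row_i ((a i : nat)%:Z - r%:Z).

(* A word lists the increments of a walk, with a flag on the recorded points. *)
Fixpoint flagged r x (ws : seq (letter r)) : seq 'rV[int]_d :=
  if ws is a :: ws' then
    let y := x + shift a.1 in
    if a.2 then y :: flagged y ws' else flagged y ws'
  else [::].

Lemma encode_walk r s w (F : pred 'rV[int]_d) : path (within r) s w ->
  exists2 ws : seq (letter r), size ws = size w &
    flagged s ws = [seq x <- w | F x].
Proof.
elim: w s => [|y w IH] s /=; first by exists [::].
move=> /andP[/withinP sy /IH[ws szw wsw]].
pose a : {ffun 'I_d -> 'I_(r.*2.+1)} :=
  [ffun i => inord `|(y 0%R i - s 0%R i + r%:Z)%R|%N].
have ya : s + shift a = y.
  apply/rowP => i; rewrite !mxE ffunE; have := sy i.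
  rewrite ler_norml => /andP[]; move: (s 0 i) (y 0 i) => b c h1 h2.
  by rewrite inordK; lia.
exists ((a, F y) :: ws) => /=; first by rewrite szw.
by rewrite ya wsw; case: (F y).
Qed.

(** Padding gives all words the same length, so that they form a finite type that can be counted. *)
Lemma encode_walk_padded r s w (F : pred 'rV[int]_d) n : path (within r) s w ->
  (size w <= n)%N ->
  exists ws : n.-tuple (letter r), flagged s ws = [seq x <- w | F x].
Proof.
move=> pw wn; have [ws szw wsw] := encode_walk F pw.
(* Without a flag this letter records nothing, although it moves the walk. *)
pose a : letter r := ([ffun=> ord0], false).
have flag0 k x : flagged x (nseq k a) = [::] by elim: k x => //= k IH x.
have sz : size (ws ++ nseq (n - size w) a) == n.
  by rewrite size_cat size_nseq szw subnKC.
exists (Tuple sz) => /=; rewrite -wsw => {szw wsw sz}.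
by elim: ws s {pw} => [|b ws IH] s /=; [rewrite flag0|rewrite !IH].
Qed.

End Walks.

Section Base.
Context {d : nat}.
Implicit Types (A : {fset 'rV[int]_d}) (x : 'rV[int]_d).

(* Base points of the boundary edges [{x, x + unitv i}] of [A]. *)
Definition base A : seq 'rV[int]_d := undup (flatten [seq
  [seq x <- A | x + unitv i \notin A] ++
  [seq x - unitv i | x <- [seq x <- A | x - unitv i \notin A]] | i <- enum 'I_d]).

Lemma mem_base A x :
  (x \in base A) = [exists i, (x \in A) != (x + unitv i \in A)].
Proof.
rewrite mem_undup; apply/flatten_mapP/existsP => -[i].
  move=> _; rewrite mem_cat mem_filter => /orP[/andP[xi xA]|/mapP[y]].
    by exists i; rewrite xA (negbTE xi).
  rewrite mem_filter => /andP[yi yA ->]; exists i.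
  by rewrite subrK yA (negbTE yi).
move=> xi; exists i; first by rewrite mem_enum.
rewrite mem_cat mem_filter; case: (boolP (x \in A)) xi => xA /= xi.
  by move: xi; case: (_ \in A).
rewrite andbF orFb; apply/mapP; exists (x + unitv i); last by rewrite addrK.
by rewrite mem_filter addrK xA; move: xi; case: (_ \in A).
Qed.

Lemma size_base A : (size (base A) <= perimeter A)%N.
Proof.
apply: (leq_trans (size_undup _)); rewrite size_flatten /shape -map_comp sumnE.
rewrite big_map big_enum/= leq_sum// => i _.
by rewrite size_cat size_map !size_filter.
Qed.

Lemma far_notin A x v : v != 0 -> exists n, forall k, (n <= k)%N -> x + v *+ k \notin A.
Proof.
move=> v0; have [n nP] := ray_far A x v0; exists n => k /nP kP.
apply/negP => /kP /negP; apply; apply/asboolP; exists 0%N.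
by rewrite mulr0n addr0.
Qed.

End Base.

(** * The trace of a set on a grid, and its code *)

Section CoarseGraining.
Context {d l : nat}.
Implicit Types (A : {fset 'rV[int]_d}).

(** The position on the axis [i] where the walk starts, the translate of the grid, and the word that
    lists the flips of the trace. *)
Definition code m : finType := ('I_m.+1 * {ffun 'I_d -> 'I_l.+1} *
  (6 * m %/ l.+1 ^ 2).-tuple (@letter d (2 * l.+1 ^ 2)))%type.

(** The corner of [x] belongs to the coded set exactly when an odd number of recorded flips lies
    ahead of it on its grid line. *)
Definition decode (i : 'I_d) m (c : code m) (x : 'rV[int]_d) : bool :=
  ray (unitv i *+ l.+1) (undup (flagged (unitv i *+ c.1.1) c.2)) (corner c.1.2 x).

(** [markov2] selects a translate with both few changed sites and few flips [D] of the trace in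
    direction [i]. The code is a walk along the boundary of [A], thinned to steps of length [r],
    with a detour to each point of [D]. *)
Lemma coarse_graining (i j : 'I_d) A (U : seq 'rV[int]_d) :
  (3 <= d)%N -> i != j -> 0 \in A -> connected1 (base A) -> uniq U ->
  exists c : code (perimeter A),
    (count (fun x => (x \in A) != decode i c x) U <= 4 * l * perimeter A)%N /\
    ((2 * perimeter A < l.+1 ^ 2)%N -> forall x, decode i c x = false).
Proof.
move=> d3 ij A0 cA uU; set m := perimeter A; set r := (l.+1 ^ 2)%N.
have r0 : (0 < r)%N by rewrite expn_gt0.
pose v := unitv i *+ l.+1.
have v0 : v != 0.
  by apply/eqP => /(mulrn_row_eq0 (unitv_neq0 i)).
have exv : (exits A v + exits A (- v) <= l.+1 * m)%N.
  rewrite -mulNrn (leq_trans (leq_add (exitsMn _ _ _) (exitsMn _ _ _)))//.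
  by rewrite -mulnDr leq_mul// /m /perimeter (bigD1 i)//= leq_addr.
have cZ : #|{: {ffun 'I_d -> 'I_l.+1}}| = (l.+1 ^ d)%N by rewrite card_ffun !card_ord.
have cZ0 : (0 < #|{: {ffun 'I_d -> 'I_l.+1}}|)%N by rewrite cZ expn_gt0.
(* The hypothesis [3 <= d] enters here: [r * l.+1 = l.+1 ^ 3] is at most the number [l.+1 ^ d] of
   translates. *)
have s2 : (\sum_(z : {ffun 'I_d -> 'I_l.+1})
    r * count (fun x => corner z x == x) (jumps A v)
    <= #|{: {ffun 'I_d -> 'I_l.+1}}| * m)%N.
  rewrite -big_distrr/= cZ; apply: (@leq_trans (r * (l.+1 * m))).
    by rewrite leq_mul2l (leq_trans (sum_grid_jumps _ _))// orbT.
  by rewrite mulnA leq_mul// /r -expnSr leq_pexp2l.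
have [z [f1 f2]] := markov2 cZ0 (sum_flip_corner A uU) s2.
pose D := [seq x <- jumps A v | corner z x == x].
have szD : (r * size D <= 2 * m)%N by rewrite size_filter.
have [n0 [n0m n0A n0A']] := exit_axis ij A0.
set s := unitv i *+ n0.
have sV : s \in base A.
  by rewrite mem_base; apply/existsP; exists i; rewrite -mulrSr n0A (negbTE n0A').
have [w [pw Vw szw]] := covering_walk cA sV.
have [w1 [pw1 szw1 w1w]] := subsample r0 pw.
have pw1' : path (within (2 * r)) s w1.
  by apply: sub_path pw1 => x y; apply: within_le; rewrite leq_pmull.
(* Between [u] and [u + v] some unit step crosses the boundary of [A]. Its base point is within [r]
   of [u], and within [r] of the thinned walk. *)
have Dnear u : u \in D -> exists2 y, y \in s :: w1 & within (2 * r) y u.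
  rewrite mem_filter mem_jumps => /andP[_ uA].
  have [k kl kA] : exists2 k, (k < l.+1)%N &
      (u + unitv i *+ k \in A) != (u + unitv i *+ k.+1 \in A).
    move: uA; rewrite /v; elim: l.+1 => [|k IH]; first by rewrite mulr0n addr0 eqxx.
    have [E|] := eqVneq (u + unitv i *+ k \in A) (u + unitv i *+ k.+1 \in A).
      by rewrite -E => /IH[k' kk' k'A]; exists k' => //; exact: leqW.
    by exists k.
  have yV : u + unitv i *+ k \in base A.
    by rewrite mem_base; apply/existsP; exists i; rewrite -addrA -mulrSr.
  have [y yw1 yk] := w1w _ (Vw _ yV); exists y => //.
  rewrite mul2n -addnn; apply: within_trans yk _.
  apply/withinP => i'; rewrite !mxE mulmxnE mxE addrAC subrr add0r eqxx/=.
  rewrite -mulrnA normr_nat natz lez_nat.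
  have : (k < r)%N by rewrite (leq_trans kl)// /r leq_pmulr.
  by case: (i' == i) => kr; rewrite ?mul1n ?mul0n// ltnW.
have [w2 [pw2 szw2 _ Dw2]] := insert_points pw1' Dnear.
(* At most [2 m / r] steps for the thinned walk, and two for each of the at most [2 m / r] flips. *)
have szw2' : (size w2 <= 6 * m %/ r)%N.
  have : (size D <= 2 * m %/ r)%N by rewrite leq_divRL// mulnC.
  have : (size w1 <= 2 * m %/ r)%N.
    apply: (leq_trans szw1); apply: leq_div2r; rewrite (leq_trans szw)//.
    by rewrite leq_mul// size_base.
  rewrite szw2 leq_divRL// => h1 h2.
  by have := leq_trunc_div (2 * m) r; clear -h1 h2; nia.
have [ws wsE] := encode_walk_padded (mem D) pw2 szw2'.
have n0lt : (n0 < m.+1)%N by [].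
exists (Ordinal n0lt, z, ws).
(* The walk may pass a flip several times; removing duplicates keeps the parities right. *)
have undupD : undup (flagged s ws) =i D.
  move=> x; rewrite mem_undup wsE mem_filter /=; apply: andb_idr; exact: Dw2.
have decE x : decode i (Ordinal n0lt, z, ws) x = (corner z x \in A).
  have [p pE] : {p | p = corner z x} by exists (corner z x).
  have pn n : corner z (p + v *+ n) = p + v *+ n.
    by rewrite /v -mulrnA cornerDM pE corner_corner.
  rewrite /decode/= -pE; apply/esym; apply: (@ray_unique _ v _ p (mem A)) => //.
  - exact: undup_uniq.
  - by move=> n; rewrite undupD mem_filter mem_jumps pn eqxx -addrA -mulrSr.
  - by have [n nP] := far_notin A p v0; exists n => k /nP/negbTE.
split.
  by under eq_count do rewrite decE; move: f1; rewrite -/m !mulnA.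
(* Here [r * size D <= 2 * m < r] leaves no room for a flip. *)
move=> mr x; have D0 : D = [::].
  by apply/nilP; rewrite /nilp; apply/eqP; move: szD mr; clear; case: (size D) => // n; nia.
rewrite /decode/= -/s.
suff -> : undup (flagged s ws) = [::] by [].
by rewrite wsE D0 /=; elim: (w2).
Qed.

End CoarseGraining.

(** * Contours and the Peierls bound *)

(** [a], [b], [c], [e] are the states of the corners of a square, and [p], [q], [r] tell whether the
    base points of its edges are selected. The hypotheses force the flipping edges to be selected
    all together or not at all, and a square has an even number of them. *)
Lemma xor_square (a b c e p q r : bool) :
  ((a != b) || (a != c) -> b != e -> p = q) ->
  ((a != b) || (a != c) -> c != e -> p = r) -> (b != e -> c != e -> q = r) ->
  p && (a != b) (+) q && (b != e) (+) r && (c != e) (+) p && (a != c) = false.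
Proof.
case: a; case: b; case: c; case: e => //=; case: p; case: q; case: r => //= H1 H2 H3;
  first [by have := H1 isT isT | by have := H2 isT isT | by have := H3 isT isT].
Qed.

Lemma count_predI_predC (T : Type) (C P : pred T) (s : seq T) :
  count C s = (count (predI C P) s + count (predI C (predC P)) s)%N.
Proof. by elim: s => //= a s ->; case: (C a); case: (P a) => /=; lia. Qed.

Section Contours.
Context {d : nat} (i j : 'I_d) (ij : i != j) (S : {fset 'rV[int]_d}).
Implicit Types (C W : pred 'rV[int]_d) (x : 'rV[int]_d).

Definition flip x k := (x \in S) != (x + unitv k \in S).

(** On [base S], [C] is a union of connected components. *)
Definition closed1 C := forall x y, x \in base S -> y \in base S -> within 1 x y -> C x -> C y.

(* The finite set whose boundary edges are those of [S] with base point in [C],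
   given as the parity of the number of crossings in direction [i]. *)
Definition inside C x := ray (unitv i) [seq y <- base S | C y && flip y i] x.

Definition edge C x k := C x && flip x k.

Lemma flip_base x k : flip x k -> x \in base S.
Proof. by move=> f; rewrite mem_base; apply/existsP; exists k. Qed.

Lemma closed1_eq C x y : closed1 C -> x \in base S -> y \in base S -> within 1 x y ->
  C x = C y.
Proof.
move=> cC xV yV xy; apply/idP/idP; first exact: cC.
by apply: cC => //; rewrite within_sym.
Qed.

Lemma within_unitv x k : within 1 x (x + unitv k).
Proof.
apply/withinP => k'; rewrite !mxE opprD addNKr normrN normr_nat.
by case: (k' == k).
Qed.

Lemma within_unitv2 x k k' : within 1 (x + unitv k) (x + unitv k').
Proof.
apply/withinP => k''; rewrite !mxE opprD addrACA subrr add0r eqxx/=.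
by case: (k'' == k); case: (k'' == k').
Qed.

Lemma edge_square C x k : closed1 C ->
  edge C x i (+) edge C (x + unitv i) k (+) edge C (x + unitv k) i (+) edge C x k
  = false.
Proof.
move=> cC.
have H1 : flip x i || flip x k -> flip (x + unitv i) k -> C x = C (x + unitv i).
  move=> f1 f2; apply: closed1_eq (within_unitv _ _) => //; last exact: flip_base f2.
  by case/orP: f1; exact: flip_base.
have H2 : flip x i || flip x k -> flip (x + unitv k) i -> C x = C (x + unitv k).
  move=> f1 f2; apply: closed1_eq (within_unitv _ _) => //; last exact: flip_base f2.
  by case/orP: f1; exact: flip_base.
have H3 : flip (x + unitv i) k -> flip (x + unitv k) i ->
    C (x + unitv i) = C (x + unitv k).
  by move=> f1 f2; apply: closed1_eq (within_unitv2 _ _ _) => //; apply: flip_base; eassumption.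
rewrite /edge /flip [x + unitv k + unitv i]addrAC; apply: xor_square => //.
by rewrite -/(flip _ _) addrAC; exact: H2.
by move=> f1 f2; apply: H3 => //; rewrite /flip addrAC.
Qed.

(** In direction [i] this holds by construction of [inside]. In another direction [k], the
    discrepancy [g] is constant along [i] by [edge_square], and it vanishes far away. *)
Lemma inside_step C x k : closed1 C -> (inside C x != inside C (x + unitv k)) = edge C x k.
Proof.
move=> cC; have e0 := unitv_neq0 i.
have uD : uniq [seq y <- base S | C y && flip y i] by rewrite filter_uniq ?undup_uniq.
have stepi y : inside C y = edge C y i (+) inside C (y + unitv i).
  rewrite {1}/inside (ray_step _ e0 uD) mem_filter; congr (_ (+) _).
  by rewrite andb_idr// => /andP[_]; exact: flip_base.
have [->|ki] := eqVneq k i.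
  by rewrite (stepi x); case: (edge _ _ _); case: (inside _ _).
pose g n := inside C (x + unitv i *+ n) (+) inside C (x + unitv k + unitv i *+ n)
  (+) edge C (x + unitv i *+ n) k.
have gS n : g n = g n.+1.
  rewrite /g mulrSr !addrA stepi (stepi (x + unitv k + unitv i *+ n)).
  set y := x + unitv i *+ n.
  have -> : x + unitv k + unitv i *+ n = y + unitv k by rewrite addrAC.
  have := edge_square y k cC; rewrite [y + unitv k + unitv i]addrAC.
  case: (edge C y i); case: (edge C _ k); case: (edge C _ i); case: (edge C _ k);
    case: (inside _ _); case: (inside _ _) => //.
have g0 n : g 0%N = g n by elim: n => // n ->.
have [n1 f1] := ray_far0 [seq y <- base S | C y && flip y i] x e0.
have [n2 f2] := ray_far0 [seq y <- base S | C y && flip y i] (x + unitv k) e0.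
have [n3 f3] := ray_far (base S) x e0.
have : g 0%N = false.
  rewrite (g0 (n1 + n2 + n3)%N) /g /inside f1 ?f2; try lia.
  rewrite /= /edge; case: (boolP (flip _ _)); rewrite ?andbF// => /flip_base yV.
  have /f3 /(_ _ yV) /negP[] : (n3 <= n1 + n2 + n3)%N by lia.
  by apply/asboolP; exists 0%N; rewrite mulr0n addr0.
rewrite /g mulr0n !addr0.
by case: (inside _ _); case: (inside _ _); case: (edge _ _ _).
Qed.

(** [inside C] is constant along lines that avoid the box, and false far along [i]. A point beyond
    the box in a coordinate other than [i] reaches infinity along [i]; otherwise it is first moved
    along [j] past the box. *)
Lemma inside_outside C N x : closed1 C -> {subset S <= box d N} -> x \notin box d N ->
  inside C x = false.
Proof.
move=> cC SN; have notS (y : 'rV[int]_d) (k : 'I_d) : N%:Z < `|y 0 k| -> y \notin S.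
  move=> yk; apply/negP => /SN/mem_boxP/(_ k); lia.
have line (y : 'rV[int]_d) (k k' : 'I_d) n : k' != k -> N%:Z < `|y 0 k| ->
    inside C y = inside C (y + unitv k' *+ n).
  move=> kk' yk; elim: n => [|n ->]; first by rewrite mulr0n addr0.
  have yn n' : N%:Z < `|(y + unitv k' *+ n') 0 k|.
    by rewrite mxE mulmxnE mxE eq_sym (negbTE kk') andbF mul0rn addr0.
  apply/eqP; rewrite mulrSr addrA -[_ == _]negbK inside_step// /edge /flip.
  by rewrite -addrA -mulrSr !(negbTE (notS _ _ (yn _))) andbF.
have caseA (y : 'rV[int]_d) (k : 'I_d) : k != i -> N%:Z < `|y 0 k| -> inside C y = false.
  move=> ki yk; have [n nP] :=
    ray_far0 [seq y <- base S | C y && flip y i] y (unitv_neq0 i).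
  by rewrite (@line y k i n) 1?eq_sym//; exact: nP.
move=> xN; have [k xk] : exists k, N%:Z < `|x 0 k|.
  apply/not_existsP => h; case/negP: xN; apply/mem_boxP => k.
  by have := h k; lia.
have [E|ki] := eqVneq k i; last exact: caseA xk.
rewrite E in xk; rewrite (@line x i j (N + `|x 0%R j|%N).+1) 1?eq_sym//.
apply: (caseA _ j); first by rewrite eq_sym.
by rewrite mxE mulmxnE mxE !eqxx /= natz; lia.
Qed.

Lemma inside_split C W : inside C 0 =
  inside (predI C W) 0 (+) inside (predI C (predC W)) 0.
Proof.
rewrite /inside /ray !count_filter; elim: (base S) => //= y V IH.
rewrite !oddD IH !oddb; case: (C y); case: (W y); case: (onray _ _ _);
  case: (flip _ _); case: (odd _); case: (odd _) => //.
Qed.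

Definition connected_part C := forall W,
  (exists x, [/\ x \in base S, C x & W x]) ->
  (forall x y, x \in base S -> y \in base S -> C x -> C y -> within 1 x y -> W x -> W y) ->
  forall y, y \in base S -> C y -> W y.

(** If the selected base points are not connected, they split into two closed parts. The parities of
    the parts add up by [inside_split], so one of them still encloses the origin, with fewer base
    points. *)
Lemma minimal_part C : closed1 C -> inside C 0 ->
  exists C', [/\ closed1 C', inside C' 0 & connected_part C'].
Proof.
have [n] := ubnP (count C (base S)); elim: n C => // n IH C Cn cC C0.
have [?|] := pselect (connected_part C); first by exists C.
move=> /existsNP[W] /not_implyP[[x [xV Cx Wx]]] /not_implyP[clW].
move=> /existsNP[y] /not_implyP[yV] /not_implyP[Cy /negP Wy].
have cl1 : closed1 (predI C W).
  move=> a b aV bV ab /= /andP[Ca Wa]; have Cb := cC _ _ aV bV ab Ca.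
  by rewrite Cb (clW a b).
have cl2 : closed1 (predI C (predC W)).
  move=> a b aV bV ab /= /andP[Ca Wa]; have Cb := cC _ _ aV bV ab Ca.
  rewrite Cb; apply: contra Wa => Wb; apply: (clW b a) => //.
  by rewrite within_sym.
have less (P : pred 'rV[int]_d) z : z \in base S -> C z -> ~~ P z ->
    (count (predI C P) (base S) < count C (base S))%N.
  move=> zV Cz Pz;
  rewrite (count_predI_predC C P) -addn1 leq_add2l -has_count; apply/hasP; exists z => //=.
  by rewrite Cz.
move: C0; rewrite (inside_split C W).
case: (boolP (inside (predI C W) 0)) => [C1 _|_ /= C2].
  by apply: IH cl1 C1; rewrite (leq_trans (less _ _ yV Cy Wy)).
apply: IH cl2 C2; apply: (@leq_trans (count C (base S))) => //.
by apply: less xV Cx _; rewrite /= Wx.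
Qed.

(** Selecting all flips gives back [S]; a connected part that still encloses the origin gives
    [A]. *)
Lemma contour N : {subset S <= box d N} -> 0 \in S -> exists A,
  [/\ 0 \in A, connected1 (base A), {subset A <= box d N} &
    forall x k, (x \in A) != (x + unitv k \in A) -> (x \in S) != (x + unitv k \in S)].
Proof.
move=> SN S0.
have clT : closed1 predT by [].
have inT : inside predT 0.
  suff -> : inside predT 0 = (0 \in S) by [].
  apply/esym/(@ray_unique _ _ _ _ (mem S)); first exact: unitv_neq0.
  - by rewrite filter_uniq ?undup_uniq.
  - move=> n; rewrite mem_filter /= /flip -addrA -mulrSr; apply/esym/andb_idr.
    move=> f; apply: (@flip_base _ i).
    by rewrite /flip -addrA -mulrSr.
  - by have [n nP] := far_notin S 0 (unitv_neq0 i); exists n => k /nP/negbTE.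
have [C [cC C0 conC]] := minimal_part clT inT.
exists [fset x in box d N | inside C x]%fset.
have memA x : (x \in [fset x in box d N | inside C x]%fset) = inside C x.
  rewrite !inE /=; have [//|xN] := boolP (x \in box d N).
  by rewrite (inside_outside cC SN xN).
have baseA x : (x \in base [fset x in box d N | inside C x]%fset) = (x \in base S) && C x.
  rewrite mem_base; apply/existsP/andP => [[k]|[]].
    rewrite !memA inside_step// => /andP[Cx f]; split => //; exact: flip_base f.
  rewrite mem_base => /existsP[k f] Cx; exists k.
  by rewrite !memA inside_step// /edge Cx.
split.
- by rewrite memA.
- move=> W [x]; rewrite baseA => /andP[xV Cx] Wx cl y; rewrite baseA => /andP[yV Cy].
  apply: (conC W) yV Cy; first by exists x.
  by move=> a b aV bV Ca Cb ab; apply: cl ab; rewrite baseA ?aV ?bV.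
- by move=> x; rewrite !inE => /andP[].
- by move=> x k; rewrite !memA inside_step// => /andP[].
Qed.

End Contours.

Section Adjacency.
Context {d : nat}.
Implicit Types x y : 'rV[int]_d.

Lemma adj_sym x y : adj x y = adj y x.
Proof. by rewrite /adj; congr (_ == _); apply: eq_bigr => i _; rewrite distrC. Qed.

Lemma adj_unitv x i : adj x (x + unitv i) /\ adj x (x - unitv i).
Proof.
have E : \sum_(j < d) `|unitv i 0 j| = 1.
  rewrite (bigD1 i)//= unitvE eqxx normr1 big1 ?addr0// => j ji.
  by rewrite unitvE (negbTE ji) normr0.
split; rewrite /adj -[X in _ == X]E; apply/eqP; apply: eq_bigr => j _; rewrite mxE.
  by rewrite opprD addNKr normrN.
by rewrite opprD addNKr [(- unitv i) _ _]mxE opprK.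
Qed.

Lemma adjP x y : adj x y -> exists i, y = x + unitv i \/ x = y + unitv i.
Proof.
move=> /eqP xy.
have [i xyi] : exists i, x 0 i != y 0 i.
  apply/not_existsP => h; have : \sum_(i < d) `|x 0 i - y 0 i| = 0.
    by apply: big1 => i _; have /negP/negPn/eqP -> := h i; rewrite subrr normr0.
  by rewrite xy.
move: xy; rewrite (bigD1 i)//=; set r := \sum_(_ | _) _ => E.
have r_ge0 : 0 <= r by apply: sumr_ge0.
have r0 : r = 0 by lia.
have eqj j : j != i -> x 0 j = y 0 j.
  move=> ji; move/eqP: r0; rewrite psumr_eq0// => /allP/(_ j (mem_index_enum _)).
  by rewrite ji => /eqP/eqP; rewrite normr_eq0 subr_eq0 => /eqP.
exists i; have [xi|xi] : y 0 i = x 0 i + 1 \/ x 0 i = y 0 i + 1 by lia.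
- left; apply/rowP => j; rewrite mxE unitvE.
  by have [->|/eqj->] := eqVneq j i; rewrite ?xi// addr0.
- right; apply/rowP => j; rewrite mxE unitvE.
  by have [->|/eqj->] := eqVneq j i; rewrite ?xi// addr0.
Qed.

End Adjacency.

(** * Exchanging two colours inside a contour *)

Section Swap.
Context {R : realType} {d q N : nat} (a : 'I_q).
Implicit Types (B : {set box d N}) (k : 'I_q) (s : config d q N)
  (h : 'I_q -> 'rV[int]_d -> R).

Definition swap_field k B h : 'I_q -> 'rV[int]_d -> R := fun c v =>
  h (if [exists u in B, fsval u == v] then tperm a k c else c) v.

Definition swap_config k B s : config d q N :=
  [ffun u => if u \in B then tperm a k (s u) else s u].

Lemma swap_fieldE k B h c (u : box d N) :
  swap_field k B h c (fsval u) = h (if u \in B then tperm a k c else c) (fsval u).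
Proof.
rewrite /swap_field; congr (h (if _ then _ else _) _).
apply/existsP/idP => [[v /andP[vB /eqP/val_inj <-]]//|uB].
by exists u; rewrite uB eqxx.
Qed.

Lemma swap_configK k B : involutive (swap_config k B).
Proof.
by move=> s; apply/ffunP => u; rewrite !ffunE; case: (u \in B); rewrite ?tpermK.
Qed.

Definition satisfied s (e : {set box d N}) : bool :=
  [forall u in e, [forall v in e, s u == s v]].

Lemma satisfied2 s u v : satisfied s [set u; v]%SET = (s u == s v).
Proof.
apply/forall_inP/eqP => [/(_ u)|uv w].
  by rewrite set21 => /(_ isT)/forall_inP/(_ v); rewrite set22 => /(_ isT)/eqP.
rewrite !inE => /orP[/eqP->|/eqP->]; apply/forall_inP => w'; rewrite !inE;
  by move=> /orP[/eqP->|/eqP->]; rewrite ?uv.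
Qed.

Definition outdeg (u : box d N) : nat := #|` fset_set (outer_neighbours u)|.

Lemma hamiltonianE eps h s : hamiltonian a eps h s =
  - ((\sum_(e in inner_edges d N) satisfied s e +
      \sum_(u : box d N) (s u == a) * outdeg u)%N%:R
     + \sum_(u : box d N) eps * h (s u) (fsval u)).
Proof.
rewrite /hamiltonian natrD !natr_sum; congr (- (_ + _ + _)).
apply: eq_bigr => u _; rewrite fsbig_finite/=; last exact: finite_outer_neighbours.
rewrite big_const_seq count_predT iter_addr addr0 natrM.
by rewrite mulr_natr.
Qed.

(** Exchanging colours in both the field and the configuration preserves the field energy, so only
    the satisfied edges have to be compared. *)
Lemma hamiltonian_swap_le k B eps h s (g : nat) :
  (\sum_(e in inner_edges d N) satisfied s e +
      \sum_(u : box d N) (s u == a) * outdeg u + g <=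
   \sum_(e in inner_edges d N) satisfied (swap_config k B s) e +
      \sum_(u : box d N) (swap_config k B s u == a) * outdeg u)%N ->
  hamiltonian a eps (swap_field k B h) (swap_config k B s) + g%:R
    <= hamiltonian a eps h s.
Proof.
move=> le; rewrite !hamiltonianE.
rewrite [X in - (_ + X) + _](_ : _ = \sum_(u : box d N) eps * h (s u) (fsval u));
  last first.
  apply: eq_bigr => u _; rewrite swap_fieldE ffunE.
  by case: (u \in B); rewrite ?tpermK.
move: le; rewrite -(ler_nat R) [X in X <= _]natrD.
set x := (_ + _)%:R; set y := (_ + _)%:R; lra.
Qed.

(** A boundary edge of [A] ends either in the box, which gives an ordered pair, or outside it, which
    contributes to [outdeg]. *)
Lemma perimeter_le (A : {fset 'rV[int]_d}) (B : {set box d N}) :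
  {subset A <= box d N} -> (forall u : box d N, (u \in B) = (fsval u \in A)) ->
  (perimeter A <= #|[set p : box d N * box d N |
       [&& adj (fsval p.1) (fsval p.2), p.1 \in B & p.2 \notin B]]%SET|
     + \sum_(u in B) outdeg u)%N.
Proof.
move=> AN BA.
pose nb (x : 'rV[int]_d) := [seq x + unitv i | i <- enum 'I_d] ++
                            [seq x - unitv i | i <- enum 'I_d].
have nb_uniq x : uniq (nb x).
  have inj : injective (@unitv d).
    by move=> i j /rowP/(_ i); rewrite !unitvE eqxx; case: eqVneq.
  rewrite cat_uniq !map_inj_uniq ?enum_uniq//=; last 2 first.
  - by move=> i j /addrI/oppr_inj/inj.
  - by move=> i j /addrI/inj.
  rewrite -!enumT !enum_uniq andbT; apply/hasPn => _ /mapP[i _ ->].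
  apply/negP => /mapP[j _ /addrI].
  by move/rowP/(_ i); rewrite mxE !unitvE eqxx; case: (_ == _).
have nb_adj x y : y \in nb x -> adj x y.
  by rewrite mem_cat => /orP[] /mapP[i _ ->]; have [] := adj_unitv x i.
have permA : perm_eq A [seq fsval u | u <- enum B].
  apply: uniq_perm; rewrite ?fset_uniq ?map_inj_uniq ?enum_uniq//; first exact: val_inj.
  move=> x; apply/idP/mapP => [xA|[u + ->]]; last by rewrite mem_enum BA.
  by exists [` AN _ xA]%fset => //; rewrite mem_enum BA.
have -> : perimeter A = (\sum_(u in B) count (fun y => y \notin A) (nb (fsval u)))%N.
  rewrite -big_enum/= -(big_map (fun u : box d N => fsval u) xpredT (fun x => count (fun y => y \notin A) (nb x))).
  rewrite -(perm_big _ permA)/= /perimeter.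
  rewrite (eq_bigr (fun i =>
    (\sum_(x <- A) ((x + unitv i \notin A)%R + (x - unitv i \notin A)%R))%N)); last first.
    by move=> i _; rewrite big_split/= /exits -!sum1_count; congr (_ + _)%N;
      rewrite big_mkcond; apply: eq_bigr => x _; case: (_ \in _).
  rewrite exchange_big/=; apply: eq_bigr => x _.
  have cE (P : pred 'I_d) : count P (enum 'I_d) = (\sum_(i < d) P i)%N.
    rewrite -sum1_count big_mkcond big_enum; apply: eq_bigr => i _.
    by case: (P i).
  rewrite /nb count_cat big_split; congr (_ + _)%N; apply/esym;
    exact: (etrans (count_map _ _ _) (cE _)).
rewrite -sum1_card (eq_bigl (fun p : box d N * box d N =>
    (p.1 \in B) && (adj (fsval p.1) (fsval p.2) && (p.2 \notin B)))); last first.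
  by move=> p; rewrite inE andbCA.
rewrite -(pair_big_dep (mem B) (fun u v => adj (fsval u) (fsval v) && (v \notin B))
  (fun _ _ => 1%N))/=.
rewrite -big_split/= leq_sum// => u uB.
rewrite (count_predI_predC _ (mem (box d N))) leq_add//.
  rewrite -size_filter sum1_card cardE -(size_map (fun v : box d N => fsval v)); apply: uniq_leq_size.
    by rewrite filter_uniq.
  move=> y; rewrite mem_filter => /andP[/andP[/= yA yN] /nb_adj uy].
  apply/mapP; exists [` yN]%fset => //.
  by rewrite mem_enum; apply/andP; rewrite uy BA.
rewrite -size_filter; apply: uniq_leq_size; first by rewrite filter_uniq.
move=> y; rewrite mem_filter => /andP[/andP[/= yA yN] /nb_adj uy].
rewrite in_fset_set ?inE; last exact: finite_outer_neighbours.
by split.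
Qed.

(** All boundary edges are unsatisfied. The exchange with [k] satisfies those joining [a] to [k] and
    breaks no satisfied edge; a best [k] gains at least the average over the [q] colours. *)
Lemma energy_gain (A : {fset 'rV[int]_d}) (B : {set box d N}) s :
  {subset A <= box d N} -> (forall u : box d N, (u \in B) = (fsval u \in A)) ->
  (forall u v : box d N, adj (fsval u) (fsval v) -> u \in B -> v \notin B ->
    (s u == a) != (s v == a)) ->
  (forall u, u \in B -> (0 < outdeg u)%N -> s u != a) ->
  exists k, forall eps h,
    hamiltonian a eps (swap_field k B h) (swap_config k B s)
      + (perimeter A)%:R / q%:R <= hamiltonian a eps h s.
Proof.
move=> AN BA inner outer.
have q0 : (0 < q)%N by apply: leq_trans (ltn_ord a).
pose T := [set p : box d N * box d N |
       [&& adj (fsval p.1) (fsval p.2), p.1 \in B & p.2 \notin B]]%SET.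
(* Exactly one endpoint of each boundary edge has colour [a]; [col] is the other colour. *)
pose col (p : box d N * box d N) := if s p.1 == a then s p.2 else s p.1.
pose gain k := (#|[set p in T | col p == k]%SET| + \sum_(u in B) (s u == k) * outdeg u)%N.
have sum_gain : (perimeter A <= \sum_k gain k)%N.
  apply: (leq_trans (perimeter_le AN BA)); rewrite -/T big_split/=; apply: leq_add.
    rewrite -sum1_card (partition_big col xpredT)//=; apply/eq_leq/eq_bigr => k _.
    by rewrite -sum1_card; apply: eq_bigl => p; rewrite [in RHS]inE.
  rewrite exchange_big/=; apply: leq_sum => u uB.
  by rewrite (bigD1 (s u))//= eqxx mul1n leq_addr.
have [k gk] : exists k, (perimeter A <= q * gain k)%N.
  apply/not_existsP => h.
  have : (\sum_(k < q) (q * gain k).+1 <= \sum_(k < q) perimeter A)%N.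
    by apply: leq_sum => k _; have := h k; rewrite ltnNge => /negP.
  under eq_bigr do rewrite -addn1.
  rewrite big_split/= -big_distrr/= !sum_nat_const card_ord muln1.
  move=> h1; have := leq_trans (leq_add (leq_mul (leqnn q) sum_gain) (leqnn q)) h1.
  by rewrite -[leqRHS]addn0 leq_add2l leqn0 => /eqP q00; rewrite q00 in q0.
exists k => eps h.
apply: (@le_trans _ _ (hamiltonian a eps (swap_field k B h) (swap_config k B s) + (gain k)%:R)).
  by rewrite lerD2l ler_pdivrMr ?ltr0n// -natrM ler_nat mulnC.
apply: hamiltonian_swap_le; rewrite /gain addnACA leq_add//; last first.
  rewrite [X in (_ + X <= _)%N]big_mkcond -big_split/= leq_sum// => u _; rewrite ffunE.
  case: (boolP (u \in B)) => uB; last by rewrite addn0.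
  have [->|/(outer u uB) sua] := posnP (outdeg u); first by rewrite !muln0.
  rewrite (negbTE sua) mul0n add0n leq_mul2r; case: (eqVneq (s u) k) => [->|_].
    by rewrite tpermR eqxx orbT.
  by rewrite orbT.
(* The energy counts unordered edges. No two pairs give the same edge, since each pair is oriented
   from [B] outwards. *)
pose E := [set [set p.1; p.2]%SET | p in [set p in T | col p == k]%SET]%SET.
have cardE : #|E| = #|[set p in T | col p == k]%SET|.
  apply: card_in_imset => -[u v] [u' v']; rewrite !inE /= -!andbA.
  move=> /and4P[_ uB vB _] /and4P[_ uB' vB' _] /setP e.
  have := e u; rewrite !inE eqxx /= => /esym/orP[/eqP uu|/eqP uv].
    have := e v; rewrite !inE eqxx orbT => /esym/orP[/eqP vu|/eqP vv].
      by move: vB; rewrite vu uB'.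
    by rewrite uu vv.
  by move: uB; rewrite uv (negbTE vB').
have EP e : e \in E -> e \in inner_edges d N /\
    satisfied s e = false /\ satisfied (swap_config k B s) e = true.
  move=> /imsetP[[u v]]; rewrite !inE /= -andbA -andbA => /and4P[uv uB vB ck] ->.
  split; first by apply/existsP; exists u; apply/existsP; exists v; rewrite uv eqxx.
  rewrite !satisfied2 !ffunE uB (negbTE vB); move: (inner u v uv uB vB) ck; rewrite /col /=.
  case: (eqVneq (s u) a) => [-> sv /eqP <-|sua]; last first.
    by case: (eqVneq (s v) a) => // -> _ /eqP <-; rewrite tpermR eqxx (negbTE sua).
  by rewrite tpermL eqxx eq_sym; move: sv; case: (s v == a).
rewrite -cardE (_ : #|E| = \sum_(e in inner_edges d N) (e \in E))%N; last first.
  rewrite -sum1_card [LHS]big_mkcond [RHS]big_mkcond; apply: eq_bigr => e _.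
  by case: (boolP (e \in E)) => [/EP[->]|_]; rewrite ?if_same.
rewrite -big_split/= leq_sum// => e eI.
have [/EP[_ [-> ->]]//|eE] := boolP (e \in E).
rewrite addn0; move: eI; rewrite inE => /existsP[u /existsP[v /andP[uv /eqP->]]].
rewrite !satisfied2 !ffunE; case: (eqVneq (s u) (s v)) => // suv.
case: (boolP (u \in B)) => uB; case: (boolP (v \in B)) => vB; rewrite suv ?eqxx//.
- by have := inner u v uv uB vB; rewrite suv eqxx.
- by have := inner v u; rewrite adj_sym uv suv eqxx vB uB => /(_ isT isT isT).
Qed.

Definition defects s : {fset 'rV[int]_d} :=
  [fset fsval u | u in [pred u : box d N | s u != a]]%fset.

Lemma mem_defects s (u : box d N) : (fsval u \in defects s) = (s u != a).
Proof.
apply/imfsetP/idP => [[v /= + /val_inj->]|su]; first by [].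
by exists u; rewrite /= ?inE.
Qed.

Lemma defects_box s x : x \in defects s -> x \in box d N.
Proof. by move=> /imfsetP[u _ ->]; exact: fsvalP. Qed.

Definition is_contour (A : {fset 'rV[int]_d}) : Prop :=
  [/\ 0 \in A, connected1 (base A) & {subset A <= box d N}].

Definition interior (A : {fset 'rV[int]_d}) : {set box d N} :=
  [set u | fsval u \in A]%SET.

Lemma contour_energy_gain (i j : 'I_d) s : i != j -> s (origin d N) != a ->
  exists A k, is_contour A /\ forall eps h,
    hamiltonian a eps (swap_field k (interior A) h) (swap_config k (interior A) s)
      + (perimeter A)%:R / q%:R <= hamiltonian a eps h s.
Proof.
move=> ij so.
have S0 : 0 \in defects s by rewrite -[0]/(fsval (origin d N)) mem_defects.
have [A [A0 cA AN AS]] := contour ij (@defects_box s) S0.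
have adjS x y : adj x y -> (x \in A) != (y \in A) ->
    (x \in defects s) != (y \in defects s).
  move=> /adjP[k [->|->]]; first exact: AS.
  by rewrite eq_sym => /AS; rewrite eq_sym.
have [|||k kP] := @energy_gain A (interior A) s AN.
- by move=> u; rewrite inE.
- move=> u v uv; rewrite !inE => uA vA; move: (adjS _ _ uv).
  by rewrite uA (negbTE vA) !mem_defects => /(_ isT); case: (s u == a); case: (s v == a).
- move=> u; rewrite !inE => uA; rewrite /outdeg cardfs_gt0 => /fset0Pn[v].
  rewrite in_fset_set ?inE; last exact: finite_outer_neighbours.
  move=> [uv vN]; move: (adjS _ _ uv); rewrite uA mem_defects.
  have vA : v \notin A by apply: contra vN; exact: AN.
  have vS : v \notin defects s by apply: contra vN; exact: defects_box.
  by rewrite (negbTE vA) (negbTE vS) => /(_ isT); case: (s u == a).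
by exists A, k; split.
Qed.

End Swap.

Arguments is_contour {d} N A.
Arguments interior {d} N A.

Lemma card_code d l m : #|{: @code d l m}| =
  (m.+1 * l.+1 ^ d * (2 * (4 * l.+1 ^ 2).+1 ^ d) ^ (6 * m %/ l.+1 ^ 2))%N.
Proof.
rewrite !card_prod card_tuple card_prod !card_ffun !card_ord card_bool.
by rewrite [(2 * _.+1 ^ d)%N]mulnC -mul2n mulnA.
Qed.

(** * The Peierls estimate, given control of the exchanged partition functions *)

Section Peierls.
Context {R : realType} {d q N : nat} (a : 'I_q).
Implicit Types (B : {set box d N}) (k : 'I_q) (s : config d q N) (m : nat)
  (T eps : R) (h : 'I_q -> 'rV[int]_d -> R).

Definition partition_function T eps h : R :=
  \sum_(s : config d q N) expR (- (T^-1 * hamiltonian a eps h s)).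

Definition contour_sets m : {set {set box d N}} :=
  [set B | `[< exists A, [/\ is_contour N A, perimeter A = m & B = interior N A] >]]%SET.

Definition max_perimeter : nat := (2 * d * #|{: box d N}|).+1.

Lemma perimeter_lt (A : {fset 'rV[int]_d}) : {subset A <= box d N} ->
  (perimeter A < max_perimeter)%N.
Proof.
move=> AN; rewrite /max_perimeter ltnS.
have szA : (size A <= #|{: box d N}|)%N.
  rewrite cardE -(size_map (fun u : box d N => fsval u)).
  apply: uniq_leq_size (fset_uniq _) _ => x xA.
  by apply/mapP; exists [` AN _ xA]%fset; rewrite ?mem_enum.
apply: (@leq_trans (\sum_(i < d) (2 * #|{: box d N}|))%N).
  apply: leq_sum => i _; rewrite mul2n -addnn.
  by rewrite leq_add// (leq_trans (count_size _ _)).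
by rewrite sum_nat_const card_ord mulnCA mulnA.
Qed.

Lemma perimeter_gt0 (i : 'I_d) (A : {fset 'rV[int]_d}) : 0 \in A -> (0 < perimeter A)%N.
Proof.
move=> A0; have [n [nA /(_ n (leqnn n)) inA]] := exit_point (unitv_neq0 i) A0.
rewrite /perimeter (bigD1 i)//= -addnA ltn_addr// -has_count.
by apply/hasP; exists (0 + unitv i *+ n) => //; rewrite -addrA -mulrSr.
Qed.

Lemma partition_function_gt0 T eps h : 0 < partition_function T eps h.
Proof.
rewrite /partition_function (bigD1 [ffun=> a])//= ltr_pwDl ?expR_gt0//.
by apply: sumr_ge0 => s _; exact: expR_ge0.
Qed.

(** Each configuration on the left has a contour and a colour whose exchange gains energy. For a
    fixed set and colour the exchange is a bijection of configurations, so the sum of the new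
    weights is a full partition function in the exchanged field. *)
Lemma contour_sum (i j : 'I_d) T eps h : i != j -> 0 < T ->
  \sum_(s : config d q N | s (origin d N) != a) expR (- (T^-1 * hamiltonian a eps h s))
  <= \sum_(m < max_perimeter) \sum_(B in contour_sets m) \sum_(k : 'I_q)
       expR (- (m%:R / (q%:R * T))) * partition_function T eps (swap_field a k B h).
Proof.
move=> ij T0.
pose F s m B k := expR (- (m%:R / (q%:R * T))) *
  expR (- (T^-1 * hamiltonian a eps (swap_field a k B h) (swap_config a k B s))).
have F0 s m B k : 0 <= F s m B k by rewrite mulr_ge0 ?expR_ge0.
have FE m B k : \sum_s F s m B k =
    expR (- (m%:R / (q%:R * T))) * partition_function T eps (swap_field a k B h).
  rewrite /F -mulr_sumr; congr (_ * _).
  by rewrite /partition_function [RHS](reindex_inj (inv_inj (swap_configK a k B))).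
apply: (@le_trans _ _ (\sum_(s : config d q N) \sum_(m < max_perimeter)
    \sum_(B in contour_sets m) \sum_(k : 'I_q) F s m B k)); last first.
  rewrite exchange_big/= ler_sum// => m _; rewrite exchange_big/= ler_sum// => B _.
  by rewrite exchange_big/= ler_sum// => k _; rewrite FE.
rewrite [leLHS]big_mkcond ler_sum// => s _; case: ifPn => [so|_]; last first.
  by rewrite sumr_ge0// => m _; rewrite sumr_ge0// => B _; rewrite sumr_ge0.
have [A [k [[A0 cA AN] HA]]] := contour_energy_gain (R := R) ij so.
have pA := perimeter_lt AN.
rewrite (bigD1 (Ordinal pA))//= ler_wpDr//.
  by rewrite sumr_ge0// => m _; rewrite sumr_ge0// => B _; rewrite sumr_ge0.
rewrite (bigD1 (interior N A))/=; last by rewrite inE; apply/asboolP; exists A.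
rewrite ler_wpDr//; first by rewrite sumr_ge0// => B _; rewrite sumr_ge0.
rewrite (bigD1 k)//= ler_wpDr ?sumr_ge0//.
rewrite /F -expRD ler_expR -opprD lerN2.
have -> : (perimeter A)%:R / (q%:R * T) = T^-1 * ((perimeter A)%:R / q%:R) :> R.
  by rewrite [RHS]mulrC -mulrA -invfM.
by rewrite -mulrDr ler_pM2l ?invr_gt0// addrC.
Qed.

(** At mesh 1, that is [l = 0], the coarse graining makes no error and the code determines the
    set. *)
Lemma card_contour_sets m (i j : 'I_d) : (3 <= d)%N -> i != j ->
  (#|contour_sets m| <= #|{: @code d 0 m}|)%N.
Proof.
move=> d3 ij.
pose f (c : @code d 0 m) : {set box d N} := [set u | decode i c (fsval u)]%SET.
pose I := [set f c | c in [set: @code d 0 m]]%SET.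
apply: (@leq_trans #|I|); last by rewrite (leq_trans (leq_imset_card _ _))// cardsT.
apply/subset_leq_card/fintype.subsetP => B.
rewrite inE => /asboolP[A [[A0 cA AN] pA ->]].
have uU : uniq [seq fsval u | u : box d N].
  by rewrite map_inj_uniq ?enum_uniq//; exact: val_inj.
have := coarse_graining (l := 0) d3 ij A0 cA uU; rewrite pA => -[c [+ _]].
rewrite muln0 mul0n leqn0 eqn0Ngt -has_count => /hasPn cP.
apply/imsetP; exists c => //; apply/setP => u; rewrite !inE.
have /cP : fsval u \in [seq fsval u | u : box d N] by apply: map_f; rewrite mem_enum.
by rewrite negbK => /eqP.
Qed.

Definition peierls_sum T : R := \sum_(1 <= m < max_perimeter)
  (#|{: @code d 0 m}| * q)%:R * expR (- (m%:R / (2 * q%:R * T))).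

(** Half of the gain [m / (q T)] pays for the exchange of the field; the other half remains in
    [peierls_sum] against the number of contours and colours. *)
Lemma peierls_bound (i j : 'I_d) T eps h : (3 <= d)%N -> i != j -> 0 < T ->
  (forall A k, is_contour N A -> partition_function T eps (swap_field a k (interior N A) h)
      <= expR ((perimeter A)%:R / (2 * q%:R * T)) * partition_function T eps h) ->
  1 - peierls_sum T <=
  potts_gibbs a T eps h [set s : config d q N | s (origin d N) == a]%SET.
Proof.
move=> d3 ij T0 ZA; rewrite /potts_gibbs /gibbs /gibbs_pmf gt_eqF//.
rewrite -/(partition_function T eps h); set Z := partition_function _ _ _.
have Z0 : 0 < Z := partition_function_gt0 T eps h.
rewrite -mulr_suml ler_pdivlMr// mulrBl mul1r lerBlDr.
rewrite {1}/Z {1}/partition_function (bigID (fun s : config d q N => s (origin d N) == a))/=.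
rewrite lerD//; first by rewrite le_eqVlt; apply/orP; left; apply/eqP/eq_bigl => s; rewrite inE.
apply: (le_trans (contour_sum _ _ ij T0)).
(* A contour contains the origin, so its perimeter is positive and the sum may start at [m = 1]. *)
have m0 B : B \notin contour_sets 0.
  rewrite inE; apply/asboolP => -[A [[A0 _ _] pA _]].
  by have := perimeter_gt0 i A0; rewrite pA.
pose G m := \sum_(B in contour_sets m) \sum_(k : 'I_q)
  expR (- (m%:R / (q%:R * T))) * partition_function T eps (swap_field a k B h).
rewrite -(big_mkord xpredT G) big_ltn// [G 0%N]big1 ?add0r; last first.
  by move=> B; rewrite (negbTE (m0 B)).
rewrite /peierls_sum mulr_suml; apply: ler_sum_nat => m _.
apply: (@le_trans _ _ (\sum_(B in contour_sets m) \sum_(k : 'I_q)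
    expR (- (m%:R / (2 * q%:R * T))) * Z)).
  apply: ler_sum => B; rewrite inE => /asboolP[A [cA <- ->]]; apply: ler_sum => k _.
  apply: (le_trans (ler_wpM2l (expR_ge0 _) (ZA A k cA))).
  rewrite mulrA -expRD ler_pM2r// ler_expR.
  have q0 : (q%:R : R) != 0.
    by rewrite pnatr_eq0 -lt0n (leq_ltn_trans _ (ltn_ord a)).
  rewrite le_eqVlt; apply/orP; left; apply/eqP; field.
  by rewrite q0 gt_eqF.
rewrite sumr_const sumr_const card_ord -mulrnA -[leLHS]mulr_natl mulrA.
rewrite !ler_wpM2r ?(ltW Z0) ?expR_ge0// ler_nat mulnC leq_mul2r.
by rewrite (@card_contour_sets m i j)// orbT.
Qed.

End Peierls.

(** * Exchanging independent Gaussian variables *)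

Section TupleMeasure.
Context {R : realType} {n : nat}.

Definition rectangle (B : 'I_n -> set R) : set (n.-tuple R) :=
  [set y | forall i, B i (tnth y i)].

Lemma measurable_rectangle B : (forall i, measurable (B i)) ->
  measurable (rectangle B).
Proof.
move=> mB; rewrite (_ : rectangle B = \bigcap_(i in [set: 'I_n]) ((@tnth n R)^~ i @^-1` B i)).
  apply: fin_bigcap_measurable => // i _.
  by rewrite -[X in measurable X]setTI; exact: measurable_tnth.
by apply/seteqP; split => [y yB i _|y yB i]; [exact: yB|exact: (yB i I)].
Qed.

(** Rectangles are stable under intersection and generate the product sigma-algebra. *)
Lemma tuple_measure_unique (m1 m2 : {measure set (n.-tuple R) -> \bar R}) :
  (m1 setT < +oo)%E ->
  (forall B, (forall i, measurable (B i)) -> m1 (rectangle B) = m2 (rectangle B)) ->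
  forall E, measurable E -> m1 E = m2 E.
Proof.
move=> m1T m12 E mE.
pose G : set (set (n.-tuple R)) := [set rectangle B | B in [set B | forall i, measurable (B i)]].
have GT : G setT.
  exists (fun=> setT) => [i /=|]; first exact: measurableT.
  by apply/seteqP; split.
apply: (measure_unique G (fun=> setT)) mE => //.
- apply/seteqP; split; last first.
    apply: smallest_sub; first exact: sigma_algebra_measurable.
    by move=> _ [B mB <-]; exact: measurable_rectangle.
  rewrite /measurable/=; apply: smallest_sub; first exact: smallest_sigma_algebra.
  rewrite -bigcup_seq; apply: bigcup_sub => i _ _ [B mB <-]; apply: sub_sigma_algebra.
  exists (fun j => if j == i then B else setT).
    by move=> j /=; case: ifP => // _; exact: measurableT.
  apply/seteqP; split => [y /(_ i)|y [_ yB] j]; first by rewrite eqxx.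
  by case: ifPn => // /eqP->.
- move=> _ _ [B mB <-] [B' mB' <-]; exists (fun i => B i `&` B' i).
    by move=> i /=; exact: measurableI.
  by apply/seteqP; split => [y yB|y [yB yB'] i]; [split=> i; case: (yB i)|split].
- by apply/seteqP; split => // y _; exists 0%N.
- by move=> _ [B mB <-]; exact: m12.
Qed.

End TupleMeasure.

(** * Integrals against the normal law *)

Section IntegralNormal.
Context {R : realType}.
Notation mu := (@lebesgue_measure R).
Local Open Scope ereal_scope.

Lemma ge0_integral_normal_prob (m s : R) (f : R -> \bar R) :
  measurable_fun setT f -> (forall x, 0 <= f x) ->
  \int[normal_prob m s]_x f x = \int[mu]_x (f x * (normal_pdf m s x)%:E).
Proof.
move=> mf f0; have dom := normal_prob_dominates m s.
rewrite -(Radon_Nikodym_SigmaFinite.change_of_variables dom)//.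
have mpdf : measurable_fun setT (fun x => (normal_pdf m s x)%:E).
  by apply/measurable_EFinP; exact: measurable_normal_pdf.
have fi := Radon_Nikodym_SigmaFinite.f_integrable dom.
apply: ae_eq_integral => //.
- by apply: emeasurable_funM => //; exact: measurable_int fi.
- exact: emeasurable_funM.
- apply: ae_eqe_mul2l; apply: integral_ae_eq => //.
  by move=> E _ mE; rewrite -(Radon_Nikodym_SigmaFinite.f_integral dom).
Qed.

(** Completing the square turns the integrand into a multiple of the normal density centred at
    [a]. *)
Lemma normal_exp_moment (a : R) :
  \int[normal_prob 0 1]_x (expR (a * x))%:E = (expR (a ^+ 2 / 2))%:E.
Proof.
rewrite ge0_integral_normal_prob//; last first.
  apply/measurable_EFinP/measurableT_comp => //; exact: measurable_funM.
under eq_integral => x _.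
  have -> : (expR (a * x))%:E * (normal_pdf 0 1 x)%:E
      = (expR (a ^+ 2 / 2))%:E * (normal_pdf a 1 x)%:E :> \bar R.
    rewrite -!EFinM !normal_pdfE ?oner_eq0//; congr (_%:E).
    rewrite mulrCA [RHS]mulrCA; congr (_ * _)%R.
    rewrite /normal_fun -!expRD; congr (expR _); by field.
  over.
rewrite ge0_integralZl//; last first.
- by move=> x _; rewrite lee_fin normal_pdf_ge0.
- by apply/measurable_EFinP; exact: measurable_normal_pdf.
by rewrite integral_normal_pdf mule1.
Qed.

End IntegralNormal.

Section IndependentPair.
Local Open Scope ereal_scope.
Context {R : realType} d {Om : measurableType d} (P : probability Om R).

(** Independence identifies the joint law with the product of the laws; Tonelli's theorem
    applies. *)
Lemma ge0_integral_prod_indep d1 d2 (T1 : measurableType d1) (T2 : measurableType d2)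
  (X : Om -> T1) (Y : Om -> T2) (f : T1 -> \bar R) (g : T2 -> \bar R) :
  measurable_fun setT X -> measurable_fun setT Y ->
  (forall A B, measurable A -> measurable B ->
    P (X @^-1` A `&` Y @^-1` B) = P (X @^-1` A) * P (Y @^-1` B)) ->
  measurable_fun setT f -> measurable_fun setT g ->
  (forall x, 0 <= f x) -> (forall y, 0 <= g y) ->
  \int[P]_w (f (X w) * g (Y w)) = \int[P]_w f (X w) * \int[P]_w g (Y w).
Proof.
move=> mX mY indep mf mg f0 g0.
pose X' : {mfun Om >-> T1} := HB.pack X (isMeasurableFun.Build _ _ _ _ X mX).
pose Y' : {mfun Om >-> T2} := HB.pack Y (isMeasurableFun.Build _ _ _ _ Y mY).
have mXY : measurable_fun setT (fun w => (X w, Y w)) by exact: measurable_fun_pair.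
pose XY' : {mfun Om >-> (T1 * T2)%type} :=
  HB.pack (fun w => (X w, Y w)) (isMeasurableFun.Build _ _ _ _ _ mXY).
have lawE : forall E, measurable E ->
    (distribution P X' \x distribution P Y') E = distribution P XY' E.
  apply: product_measure_unique => A B mA mB.
  rewrite /distribution /pushforward /= -indep//.
have mfg : measurable_fun setT (fun z : T1 * T2 => f z.1 * g z.2).
  by apply: emeasurable_funM; apply: measurableT_comp.
transitivity (\int[distribution P XY']_z (f z.1 * g z.2)).
  by rewrite ge0_integral_distribution// => z; rewrite mule_ge0.
rewrite -(eq_measure_integral _ (fun E mE _ => lawE E mE)).
rewrite fubini_tonelli1//; last by move=> z; rewrite mule_ge0.
under eq_integral.
  move=> x _; rewrite /fubini_F/= ge0_integralZl//.
  over.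
rewrite /=.
rewrite ge0_integralZr//=; last exact: integral_ge0.
by rewrite !ge0_integral_distribution.
Qed.

End IndependentPair.

(** * Finite samples of independent standard Gaussian variables *)

Section IidGaussian.
Context {R : realType} {d} {Om : measurableType d} (P : probability Om R)
  (I : choiceType) (X : I -> {RV P >-> R}) (iidX : iid_standard_gaussian X).

Definition sample n (s : n.-tuple I) (w : Om) : n.-tuple R :=
  [tuple X (tnth s i) w | i < n].

Lemma measurable_sample n (s : n.-tuple I) : measurable_fun setT (sample s).
Proof.
apply/measurable_fun_tnthP => i.
rewrite (_ : _ \o _ = X (tnth s i)); first exact: measurable_funP.
by apply/funext => w /=; rewrite tnth_mktuple.
Qed.

Lemma probability_EFin (E : set Om) : measurable E -> P E = (fine (P E))%:E.
Proof. by move=> mE; rewrite fineK// fin_num_measure. Qed.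

Lemma sample_rectangle n (s : n.-tuple I) (B : 'I_n -> set R) : uniq s ->
  (forall i, measurable (B i)) ->
  P (sample s @^-1` rectangle B) = (\prod_(i < n) fine (normal_prob 0 1 (B i)))%:E.
Proof.
move=> us mB; have mE := measurable_sample s _ (measurable_rectangle mB).
rewrite setTI in mE; rewrite probability_EFin//; last exact: mE.
(* Independence speaks of families over all of [I]; indices outside [s] receive the full set. *)
pose B' x := oapp B setT (insub (index x s)).
have B'E i : B' (tnth s i) = B i.
  rewrite /B' (tnth_nth (tnth s i)) index_uniq ?size_tuple// insubT//= => lt.
  by congr B; apply/val_inj.
have mB' x : measurable (B' x).
  by rewrite /B'; case: insub => [i|] /=; [exact: mB|exact: measurableT].
pose J := [fset x in (s : seq I)]%fset.
have JE : perm_eq J s.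
  by apply: uniq_perm => //; move=> x; rewrite !inE.
have [indep gauss] := iidX.
congr EFin; transitivity (fine (P (\bigcap_(i in [set` J]) (X i @^-1` B' i)))).
  congr (fine (P _)); apply/seteqP; split => [w wB x /=|w wB i].
    rewrite inE => /tnthP[i ->]; rewrite B'E.
    by have := wB i; rewrite /= tnth_mktuple.
  have /wB : [set` J] (tnth s i) by rewrite /= inE mem_tnth.
  by rewrite /= B'E tnth_mktuple.
rewrite indep// (perm_big _ JE)/= (big_tnth _ _ s)/=.
rewrite (eq_bigr (fun i : 'I_(size s) => fine (normal_prob 0 1 (B' (tnth (in_tuple s) i))))); last first.
  by move=> i _; rewrite -(gauss (tnth (in_tuple s) i) _ (mB' _)).
rewrite -(big_tnth _ _ s xpredT (fun x => fine (normal_prob 0 1 (B' x)))) big_tuple.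
by apply: eq_bigr => i _; rewrite B'E.
Qed.

Definition sample_mfun n (s : n.-tuple I) : {mfun Om >-> n.-tuple R} :=
  HB.pack (sample s) (isMeasurableFun.Build _ _ _ _ _ (measurable_sample s)).

(** The two laws agree on rectangles. For two listings of the same variables this gives the
    invariance of the field under exchanges of colours. *)
Lemma sample_law n (s s' : n.-tuple I) (E : set (n.-tuple R)) : uniq s -> uniq s' ->
  measurable E -> P (sample s @^-1` E) = P (sample s' @^-1` E).
Proof.
move=> us us' mE; rewrite -[LHS]/(distribution P (sample_mfun s) E).
rewrite -[RHS]/(distribution P (sample_mfun s') E).
apply: tuple_measure_unique mE => [|B mB].
  rewrite (_ : _ setT = 1%E) ?ltry//.
  exact: (probability_setT (distribution P (sample_mfun s))).
exact: etrans (sample_rectangle us mB) (esym (sample_rectangle us' mB)).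
Qed.

Lemma integral_sample n (s s' : n.-tuple I) (f : n.-tuple R -> \bar R) :
  uniq s -> uniq s' -> measurable_fun setT f -> (forall y, 0 <= f y)%E ->
  (\int[P]_w f (sample s w) = \int[P]_w f (sample s' w))%E.
Proof.
move=> us us' mf f0.
have := ge0_integral_distribution (sample_mfun s) mf f0.
have := ge0_integral_distribution (sample_mfun s') mf f0.
rewrite /comp /= => <- <-; apply: eq_measure_integral => E mE _.
exact: sample_law.
Qed.

(** With [A] fixed, both sides are finite measures in [E], which are compared on rectangles. *)
Lemma sample_cons_indep n (i : I) (s : n.-tuple I) (A : set R) (E : set (n.-tuple R)) :
  uniq (i :: s) -> measurable A -> measurable E ->
  (P (X i @^-1` A `&` sample s @^-1` E) = P (X i @^-1` A) * P (sample s @^-1` E))%E.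
Proof.
move=> uis mA mE.
have us : uniq s by case/andP: uis.
have mXA : measurable (X i @^-1` A) by rewrite -[X in measurable X]setTI; exact: measurable_funP.
have mY := measurable_sample s.
pose r : {nonneg R} := NngNum (fine_ge0 (measure_ge0 P (X i @^-1` A))).
have PA : P (X i @^-1` A) = (r%:num)%:E by rewrite probability_EFin.
transitivity (pushforward (mrestr P mXA) (sample_mfun s) E).
  by rewrite /pushforward /= /mrestr setIC.
transitivity (mscale r (distribution P (sample_mfun s)) E); last first.
  by rewrite /mscale/= -PA.
move: E mE; apply: tuple_measure_unique => [|B mB].
  rewrite /pushforward /= /mrestr; apply: (@le_lt_trans _ _ (P setT)).
    by apply: le_measure; rewrite ?inE//; apply: measurableI => //; rewrite preimage_setT.
  by rewrite probability_setT ltry.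
rewrite /pushforward /= /mrestr /mscale /= /distribution /pushforward /=.
pose Bc (k : 'I_n.+1) := oapp B A (unlift ord0 k).
have mBc k : measurable (Bc k).
  by rewrite /Bc; case: unlift => [j|] /=; [exact: mB|exact: mA].
have := sample_rectangle (s := [tuple of i :: s]) uis mBc.
rewrite (_ : sample _ @^-1` _ = sample s @^-1` rectangle B `&` X i @^-1` A); last first.
  apply/seteqP; split => [w wB|w [wB wA] k] /=.
    split=> [k|].
      have := wB (lift ord0 k); rewrite /Bc liftK /= !tnth_mktuple.
      by rewrite tnthS.
    by have := wB ord0; rewrite /Bc unlift_none /= tnth_mktuple tnth0.
  rewrite /Bc tnth_mktuple; case: unliftP => [j ->|->] /=.
    by have := wB j; rewrite tnth_mktuple tnthS.
  by rewrite tnth0.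
move=> ->; rewrite sample_rectangle// -EFinM big_ord_recl /Bc unlift_none/=.
congr (_ * _)%:E; last by apply: eq_bigr => k _; rewrite liftK.
have [_ gauss] := iidX; by rewrite -(gauss i A mA).
Qed.

Lemma exp_moment_sum (s : seq I) (a : I -> R) : uniq s ->
  (\int[P]_w (expR (\sum_(i <- s) a i * X i w))%:E
    = (expR (\sum_(i <- s) a i ^+ 2 / 2))%:E)%E.
Proof.
elim: s => [_|i s IH uis].
  under eq_integral do rewrite big_nil.
  by rewrite big_nil expR0 integral_cst// mul1e; exact: probability_setT.
have us : uniq s by case/andP: uis.
pose f (x : R) := (expR (a i * x))%:E.
pose g (y : (size s).-tuple R) :=
  (expR (\sum_(k < size s) a (tnth (in_tuple s) k) * tnth y k))%:E.
have mf : measurable_fun setT f.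
  by apply/measurable_EFinP/measurableT_comp => //; exact: measurable_funM.
have mg : measurable_fun setT g.
  apply/measurable_EFinP/measurableT_comp => //.
  apply: measurable_sum => k; apply: measurable_funM => //.
  exact: measurable_tnth.
have gE w : g (sample (in_tuple s) w) = (expR (\sum_(i <- s) a i * X i w))%:E.
  congr (expR _)%:E; rewrite [RHS]big_tnth; apply: eq_bigr => k _.
  by rewrite tnth_mktuple.
transitivity (\int[P]_w (f (X i w) * g (sample (in_tuple s) w)))%E.
  by apply: eq_integral => w _; rewrite big_cons expRD gE EFinM.
rewrite (ge0_integral_prod_indep (X := X i) (Y := sample (in_tuple s)))//.
- under [in X in (_ * X)%E]eq_integral do rewrite gE.
  rewrite IH// big_cons expRD EFinM; congr (_ * _)%E.
  have f0 x : (0 <= f x)%E by rewrite lee_fin expR_ge0.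
  transitivity (\int[distribution P (X i)]_x f x)%E.
    by rewrite ge0_integral_distribution.
  rewrite -normal_exp_moment.
  (* The identity carries the normal law from one measurable structure on [R] to the other. *)
  pose toR : measurableTypeR R -> R := idfun.
  have mtoR : measurable_fun [set: measurableTypeR R] toR.
    by move=> _ A mA; rewrite setTI.
  transitivity (\int[pushforward (normal_prob 0 1) toR]_x f x)%E; last first.
    by rewrite ge0_integral_pushforward.
  apply: eq_measure_integral => A mA _.
  have [_ gauss] := iidX; exact: gauss.
- exact: measurable_sample.
- by move=> A B mA mB; exact: sample_cons_indep.
- by move=> x; rewrite lee_fin expR_ge0.
- by move=> x; rewrite lee_fin expR_ge0.
Qed.

End IidGaussian.

(** * Symmetric differences, and averages over partial exchanges *)

Section SymmetricDifference.
Context {V : finType}.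
Implicit Types (A B C : {set V}) (v : V).

Definition symdiff A B : {set V} := [set v | (v \in A) (+) (v \in B)]%SET.

Lemma in_symdiff A B v : (v \in symdiff A B) = (v \in A) (+) (v \in B).
Proof. by rewrite inE. Qed.

Lemma symdiffC A B : symdiff A B = symdiff B A.
Proof. by apply/setP => v; rewrite !in_symdiff addbC. Qed.

Lemma symdiffA A B C : symdiff A (symdiff B C) = symdiff (symdiff A B) C.
Proof. by apply/setP => v; rewrite !in_symdiff addbA. Qed.

Lemma symdiffK A B : symdiff A (symdiff A B) = B.
Proof. by apply/setP => v; rewrite !in_symdiff addbA addbb. Qed.

Lemma symdiff0 A : symdiff A finset.set0 = A.
Proof. by apply/setP => v; rewrite in_symdiff inE addbF. Qed.

Definition toggle v C : {set V} := symdiff [set v]%SET C.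

Lemma toggleC u v C : toggle u (toggle v C) = toggle v (toggle u C).
Proof. by rewrite /toggle symdiffA [symdiff [set u]%SET _]symdiffC -symdiffA. Qed.

Lemma toggleK v : involutive (toggle v).
Proof. by move=> C; exact: symdiffK. Qed.

Lemma symdiff_toggle A v C : symdiff A (toggle v C) = toggle v (symdiff A C).
Proof. by rewrite /toggle symdiffA [symdiff A _]symdiffC -symdiffA. Qed.

Lemma foldr_toggle A C : foldr toggle C (enum A) = symdiff A C.
Proof.
apply/setP => v; rewrite in_symdiff -(mem_enum A).
elim: (enum A) (enum_uniq (mem A)) => [|u s IH] //=.
move=> /andP[us /IH E]; rewrite /toggle in_symdiff E inE in_cons.
have [->|] := eqVneq v u; last by rewrite addFb.
by rewrite (negbTE us).
Qed.

End SymmetricDifference.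

Section Averaging.
Context {R : realType} {V : finType}.
Implicit Types (f g : {set V} -> R) (C : {set V}) (vs : seq V) (v : V).

Definition cosh (x : R) : R := (expR x + expR (- x)) / 2.

Lemma cosh_abs x : cosh `|x| = cosh x.
Proof. by rewrite /cosh; case: (ger0P x) => _ //; rewrite opprK addrC. Qed.

Lemma cosh_ge0 x : 0 <= cosh x.
Proof. by rewrite divr_ge0// addr_ge0 ?expR_ge0. Qed.

Lemma ler_cosh x y : `|x| <= y -> cosh x <= cosh y.
Proof.
move=> xy; rewrite -cosh_abs; move: xy (normr_ge0 x); move: `|x| => {}x xy x0.
rewrite /cosh ler_pM2r//.
(* With [a = expR x] and [b = expR y >= a >= 1], [b + b^-1 - a - a^-1 = (b - a) (1 - (a b)^-1)]. *)
have a1 : 1 <= expR x by rewrite -expR0 ler_expR.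
have ab : expR x <= expR y by rewrite ler_expR.
rewrite !expRN; set a := expR x in a1 ab *; set b := expR y in ab *.
have a0 : 0 < a by rewrite expR_gt0.
have b0 : 0 < b by rewrite expR_gt0.
rewrite -subr_ge0 (_ : _ - _ = (b - a) * (1 - (a * b)^-1)); last first.
  by field; rewrite !gt_eqF.
rewrite mulr_ge0 ?subr_ge0// invf_le1 ?mulr_gt0//.
by rewrite mulr_ege1// (le_trans a1).
Qed.

(** For duplicate-free [vs], the mean of [f (symdiff D C)] over the subsets [D] of [vs], taken one
    element at a time. *)
Fixpoint average vs f C : R :=
  if vs is v :: vs' then (average vs' f C + average vs' f (toggle v C)) / 2 else f C.

Lemma average_symdiff vs f A C :
  average vs (f \o symdiff A) C = average vs f (symdiff A C).
Proof. by elim: vs C => //= u vs IH C; rewrite !IH symdiff_toggle. Qed.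

Lemma average_invariant vs f v C : v \in vs ->
  average vs f (toggle v C) = average vs f C.
Proof.
elim: vs C => //= u vs IH C; rewrite inE => /orP[/eqP->|vvs].
  by rewrite toggleK addrC.
by rewrite toggleC !IH.
Qed.

Lemma averageN vs f C : average vs (fun C => - f C) C = - average vs f C.
Proof. by elim: vs C => //= v vs IH C; rewrite !IH -opprD mulNr. Qed.

(** The mean is invariant under toggling each element of [A], hence under [symdiff A], which negates
    [f]. *)
Lemma average_odd f A C : (forall C, f (symdiff A C) = - f C) ->
  average (enum A) f C = 0.
Proof.
move=> oddf; have E : average (enum A) f (symdiff A C) = average (enum A) f C.
  rewrite -foldr_toggle.
  suff H s : {subset s <= enum A} ->
      average (enum A) f (foldr toggle C s) = average (enum A) f C by exact: H.
  elim: s => //= v s IH sub; rewrite average_invariant ?sub ?mem_head// IH// => u us.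
  by apply: sub; rewrite inE us orbT.
have : average (enum A) f C = - average (enum A) f C.
  rewrite -[LHS]E -average_symdiff -averageN; congr average.
  by apply/funext => C' /=; exact: oddf.
lra.
Qed.

Lemma average_lipschitz vs f v (c : R) :
  (forall C, `|f (toggle v C) - f C| <= c) ->
  forall C, `|average vs f (toggle v C) - average vs f C| <= c.
Proof.
move=> fc; elim: vs => //= u vs IH C; rewrite [toggle u (toggle v C)]toggleC.
rewrite -mulrBl opprD addrACA normrM normfV normr_nat ler_pdivrMr//.
rewrite (le_trans (ler_normD _ _))// mulr_natr mulr2n lerD//.
Qed.

(** Averaging over one element replaces two exponentials by that of their midpoint [m] times
    [cosh x], where [x] is half the difference of the exponents. As the partial averages keep the
    Lipschitz bounds of [f], [x] is at most [c v] in absolute value. *)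
Lemma average_expR_le vs f (c : V -> R) C :
  (forall v C, v \in vs -> `|f (toggle v C) - f C| <= 2 * c v) ->
  average vs (expR \o f) C <= expR (average vs f C) * \prod_(v <- vs) cosh (c v).
Proof.
elim: vs C => [|v vs IH] C fc /=; first by rewrite big_nil mulr1.
rewrite big_cons; set Q := \prod_(_ <- _) _.
have Q0 : 0 <= Q by apply: prodr_ge0 => u _; exact: cosh_ge0.
have fc' u C' : u \in vs -> `|f (toggle u C') - f C'| <= 2 * c u.
  by move=> uvs; apply: fc; rewrite inE uvs orbT.
set g := average vs f.
apply: (@le_trans _ _ ((expR (g C) * Q + expR (g (toggle v C)) * Q) / 2)).
  by rewrite ler_pM2r// lerD// IH.
rewrite -mulrDl mulrAC mulrA ler_wpM2r//.
pose m := (g C + g (toggle v C)) / 2; pose x := (g (toggle v C) - g C) / 2.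
have -> : (expR (g C) + expR (g (toggle v C))) / 2 = expR m * cosh x.
  have -> : g C = m - x by rewrite /m /x; field.
  have -> : g (toggle v C) = m + x by rewrite /m /x; field.
  by rewrite !expRD /cosh; field.
rewrite ler_pM2l ?expR_gt0//; apply: ler_cosh.
rewrite /x normrM normfV normr_nat ler_pdivrMr// mulrC.
by apply: average_lipschitz => C'; apply: fc; rewrite mem_head.
Qed.

End Averaging.

(** * Free energies of exchanged fields *)

Section FreeEnergy.
Context {R : realType} {d q N : nat} (a k : 'I_q).
Implicit Types (B C : {set box d N}) (s : config d q N)
  (T eps : R) (h : 'I_q -> 'rV[int]_d -> R).

Definition free_energy T eps h : R := T * ln (@partition_function R d q N a T eps h).

Lemma free_energy_le T eps h h' (c : R) : 0 < T ->
  (forall s : config d q N, hamiltonian a eps h' s <= hamiltonian a eps h s + c) ->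
  free_energy T eps h <= free_energy T eps h' + c.
Proof.
move=> T0 hh'; rewrite /free_energy -ler_pdivlMl// mulrDr mulrA mulVf ?gt_eqF// mul1r.
rewrite -[X in _ + X]expRK -lnM ?posrE ?expR_gt0 ?partition_function_gt0//.
rewrite ler_ln ?posrE ?mulr_gt0 ?expR_gt0 ?partition_function_gt0//.
rewrite /partition_function mulr_suml ler_sum// => s _.
rewrite -expRD ler_expR -[X in _ + X]mulrC.
have := hh' s; rewrite -(ler_pM2l (x := T^-1)) ?invr_gt0// mulrDr; lra.
Qed.

Lemma eq_free_energy T eps h h' : (forall c (u : box d N), h c (fsval u) = h' c (fsval u)) ->
  free_energy T eps h = free_energy T eps h'.
Proof.
move=> hh'; rewrite /free_energy /partition_function; congr (_ * ln _).
apply: eq_bigr => s _; rewrite !hamiltonianE; congr (expR (- (_ * - (_ + _)))).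
by apply: eq_bigr => u _; rewrite hh'.
Qed.

Lemma free_energy_swap_swap T eps B C h :
  free_energy T eps (swap_field a k B (swap_field a k C h)) =
  free_energy T eps (swap_field a k (symdiff B C) h).
Proof.
apply: eq_free_energy => c u; rewrite !swap_fieldE in_symdiff.
by case: (u \in B); case: (u \in C); rewrite //= tpermK.
Qed.

(** Toggling [v] exchanges only the values for [a] and [k] at [v], which bounds the change of every
    energy and therefore of the free energy. *)
Lemma free_energy_toggle_le T eps v C h : 0 < T -> 0 <= eps ->
  `|free_energy T eps (swap_field a k (toggle v C) h)
    - free_energy T eps (swap_field a k C h)|
  <= eps * `|h a (fsval v) - h k (fsval v)|.
Proof.
move=> T0 eps0; pose D := `|h a (fsval v) - h k (fsval v)|.
have Hle C' s : hamiltonian a eps (swap_field a k (toggle v C') h) s <=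
    hamiltonian a eps (swap_field a k C' h) s + eps * D.
  rewrite !hamiltonianE; set x := (_ + _)%:R.
  suff : \sum_(u : box d N) eps * swap_field a k C' h (s u) (fsval u) <=
      \sum_(u : box d N) eps * swap_field a k (toggle v C') h (s u) (fsval u) + eps * D.
    by move=> le; lra.
  rewrite (bigD1 v)//= [X in _ <= X + _](bigD1 v)//=.
  rewrite [X in _ + X <= _](_ : _ =
      \sum_(u | u != v) eps * swap_field a k (toggle v C') h (s u) (fsval u)); last first.
    apply: eq_bigr => u uv; rewrite !swap_fieldE /toggle in_symdiff inE.
    by rewrite (negbTE uv) addFb.
  rewrite addrAC lerD2r -mulrDr ler_wpM2l// !swap_fieldE /toggle in_symdiff inE eqxx.
  rewrite -lerBlDl (le_trans (ler_norm _))// /D.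
  case: (v \in C') => /=; case: tpermP => [->|->|_ _]; rewrite ?subrr ?normr0//.
  - by rewrite distrC.
  - by rewrite distrC.
rewrite -/D ler_norml.
have := free_energy_le T0 (Hle C); have := free_energy_le T0 (Hle (toggle v C)).
by rewrite toggleK => h1 h2; apply/andP; split; lra.
Qed.

End FreeEnergy.

Section IntegralAverage.
Context {R : realType} {d} {Om : measurableType d} (P : probability Om R).
Local Open Scope ereal_scope.

(** The common value [e] may be infinite: in [integral_average] the moment is not yet known to be
    finite. *)
Lemma integral_mean (f g : Om -> R) (e : \bar R) :
  measurable_fun setT f -> measurable_fun setT g ->
  (forall w, 0 <= f w)%R -> (forall w, 0 <= g w)%R ->
  \int[P]_w (f w)%:E = e -> \int[P]_w (g w)%:E = e ->
  \int[P]_w ((f w + g w) / 2)%:E = e.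
Proof.
move=> mf mg f0 g0 fe ge.
have e0 : 0 <= e by rewrite -fe; apply: integral_ge0 => w _; rewrite lee_fin.
under eq_integral do rewrite EFinM EFinD.
rewrite ge0_integralZr//; last 2 first.
- by apply/measurable_EFinP; exact: measurable_funD.
- by move=> w _; rewrite -EFinD lee_fin addr_ge0.
rewrite ge0_integralD//; last 4 first.
- by move=> w _; rewrite lee_fin.
- exact/measurable_EFinP.
- by move=> w _; rewrite lee_fin.
- exact/measurable_EFinP.
rewrite fe ge; case: e e0 {fe ge} => [r| |]// r0.
  by rewrite -EFinD -EFinM; congr EFin; field.
by rewrite addye// mulyr gtr0_sg// mul1e.
Qed.

Lemma measurable_average (V : finType) (W : {set V} -> Om -> R) vs C :
  (forall C, measurable_fun setT (W C)) ->
  measurable_fun setT (fun w => average vs (W ^~ w) C).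
Proof.
move=> mW; elim: vs C => //= v vs IH C.
by apply: measurable_funM => //; exact: measurable_funD.
Qed.

Lemma average_ge0 (V : finType) (f : {set V} -> R) vs C :
  (forall C, 0 <= f C)%R -> (0 <= average vs f C)%R.
Proof. by move=> f0; elim: vs C => //= v vs IH C; rewrite divr_ge0// addr_ge0. Qed.

Lemma integral_average (V : finType) (W : {set V} -> Om -> R) vs C e :
  (forall C, measurable_fun setT (W C)) -> (forall C w, 0 <= W C w)%R ->
  (forall C, \int[P]_w (W C w)%:E = e) ->
  \int[P]_w (average vs (W ^~ w) C)%:E = e.
Proof.
move=> mW W0 We; elim: vs C => //= v vs IH C.
by apply: integral_mean => //; try exact: measurable_average;
  move=> w; apply: average_ge0.
Qed.

End IntegralAverage.

Lemma mulrB_exchange (R : comPzRingType) (t x y z u : R) :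
  t * (x - y) - t * (z - u) = t * ((x - z) - (y - u)).
Proof. by ring. Qed.

(** * The exponential moment of a difference of free energies *)

Section SwapMoment.
Context {R : realType} {d q N : nat} {dsp} {Om : measurableType dsp}
  (P : probability Om R) (h : 'I_q -> 'rV[int]_d -> {RV P >-> R})
  (iidh : iid_standard_gaussian (fun kv : 'I_q * 'rV[int]_d => h kv.1 kv.2))
  (a k : 'I_q).
Let X (kv : 'I_q * 'rV[int]_d) := h kv.1 kv.2.
Let fld (w : Om) c v := h c v w.
Local Notation fe := (@free_energy R d q N a).
Implicit Types (B C : {set box d N}) (T eps : R).

Lemma measurable_diff (u : box d N) :
  measurable_fun setT (fun w => h a (fsval u) w - h k (fsval u) w).
Proof. by apply: measurable_funB; exact: measurable_funP. Qed.

Lemma measurable_prod_cosh (r : R) (vs : seq (box d N)) : measurable_fun setT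
  (fun w => \prod_(v <- vs) cosh (r * (h a (fsval v) w - h k (fsval v) w))).
Proof.
apply: measurable_prod => u _; rewrite /cosh.
have mr : measurable_fun setT (fun w => r * (h a (fsval u) w - h k (fsval u) w)).
  by apply: measurable_funM => //; exact: measurable_diff.
apply: measurable_funM => //; apply: measurable_funD; apply: measurableT_comp => //.
exact: measurableT_comp.
Qed.

(** The induction expands one [cosh] at a time into the mean of two exponentials, moving its site
    from [vs] to [ws] with either sign. At the end each site carries two independent variables, each
    contributing [r ^+ 2 / 2]. *)
Lemma exp_moment_cosh (r : R) (vs ws : seq (box d N)) (sg : 'rV[int]_d -> bool) :
  a != k -> uniq (vs ++ ws) ->
  (\int[P]_w (\prod_(v <- vs) cosh (r * (h a (fsval v) w - h k (fsval v) w)) *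
     expR (\sum_(v <- ws) (-1) ^+ sg (fsval v) * r *
        (h a (fsval v) w - h k (fsval v) w)))%:E
   = (expR ((size vs + size ws)%:R * r ^+ 2))%:E)%E.
Proof.
move=> ak; elim: vs ws sg => [|v vs IH] ws sg.
  rewrite cat0s => uws.
  pose s : seq ('I_q * 'rV[int]_d) :=
    [seq (a, fsval v) | v <- ws] ++ [seq (k, fsval v) | v <- ws].
  pose b (p : 'I_q * 'rV[int]_d) : R :=
    (if p.1 == a then 1 else -1) * ((-1) ^+ sg p.2 * r).
  have us : uniq s.
    have inj c : injective (fun v : box d N => (c : 'I_q, fsval v)).
      by move=> u v [/val_inj].
    rewrite cat_uniq !map_inj_uniq// uws andbT /=.
    apply/hasPn => _ /mapP[v _ ->]; apply/negP => /mapP[u _ [ka _]].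
    by rewrite ka eqxx in ak.
  have := exp_moment_sum iidh b us.
  have -> : \sum_(i <- s) b i ^+ 2 / 2 = (size ws)%:R * r ^+ 2.
    rewrite (eq_bigr (fun=> r ^+ 2 / 2)); last first.
      move=> p _; rewrite /b !exprMn -signr_odd /=; congr (_ / _).
      by case: (p.1 == a); case: (sg p.2); rewrite /= ?expr0 ?expr1 ?sqrrN !expr1n !mul1r.
    rewrite big_const_seq count_predT iter_addr addr0 /s size_cat !size_map.
    by rewrite -[LHS]mulr_natl natrD; field.
  rewrite /= => <-; apply: eq_integral => w _; congr (_%:E).
  rewrite big_nil mul1r; congr expR; rewrite /s big_cat/= !big_map -big_split/=.
  apply: eq_bigr => v _; rewrite /b /= eqxx [k == a]eq_sym (negbTE ak).
  by ring.
move=> /= /andP[]; rewrite mem_cat negb_or => /andP[vvs vws] uvs.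
pose sgb (b : bool) (x : 'rV[int]_d) := if x == fsval v then b else sg x.
pose F b w := \prod_(v <- vs) cosh (r * (h a (fsval v) w - h k (fsval v) w)) *
     expR (\sum_(v <- v :: ws) (-1) ^+ sgb b (fsval v) * r *
        (h a (fsval v) w - h k (fsval v) w)).
have mF b : measurable_fun setT (F b).
  apply: measurable_funM.
    exact: measurable_prod_cosh.
  apply: measurableT_comp => //; apply: measurable_sum => u.
  apply: measurable_funM => //; exact: measurable_diff.
have F0 b w : 0 <= F b w.
  by rewrite mulr_ge0 ?expR_ge0// prodr_ge0// => u _; exact: cosh_ge0.
have IF b : (\int[P]_w (F b w)%:E =
    (expR ((size (v :: vs) + size ws)%:R * r ^+ 2))%:E)%E.
  rewrite /F IH; first by rewrite /= addnS.
  by rewrite uniq_catC /= mem_cat negb_or vws vvs uniq_catC.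
rewrite -(integral_mean (mF true) (mF false) (F0 true) (F0 false) (IF true) (IF false)).
apply: eq_integral => w _; congr (_%:E); rewrite /F.
have sgE b : \sum_(v0 <- ws) (-1) ^+ sgb b (fsval v0) * r *
        (h a (fsval v0) w - h k (fsval v0) w) =
    \sum_(v0 <- ws) (-1) ^+ sg (fsval v0) * r *
        (h a (fsval v0) w - h k (fsval v0) w).
  apply: eq_big_seq => u uws; rewrite /sgb (inj_eq val_inj).
  by case: eqVneq uws vws => [->->|].
rewrite !big_cons !sgE /sgb eqxx !expRD expr0 expr1 mulN1r mul1r mulNr /cosh.
by ring.
Qed.

Definition field_of (y : #|{: 'I_q * box d N}|.-tuple R) : 'I_q -> 'rV[int]_d -> R :=
  fun c v => if insub v is Some u then tnth y (enum_rank (c, u)) else 0.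

(** The variables in the order in which the field exchanged on [C] reads them, as [field_of_sample]
    shows. *)
Definition sites C : #|{: 'I_q * box d N}|.-tuple ('I_q * 'rV[int]_d) :=
  [tuple let p := enum_val i in
    (if p.2 \in C then tperm a k p.1 else p.1, fsval p.2)
  | i < #|{: 'I_q * box d N}|].

Lemma uniq_sites C : uniq (sites C).
Proof.
rewrite map_inj_uniq ?enum_uniq// => i j /=.
case: (enum_val i) (enum_valK i) => c u /= <-.
case: (enum_val j) (enum_valK j) => c' u' /= <- [+ /val_inj uu']; rewrite uu'.
by case: (u' \in C) => [/perm_inj|] ->.
Qed.

Lemma field_of_box y c (u : box d N) :
  field_of y c (fsval u) = tnth y (enum_rank (c, u)).
Proof. by rewrite /field_of valK. Qed.

Lemma field_of_sample C w c (u : box d N) :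
  field_of (sample X (sites C) w) c (fsval u) = swap_field a k C (fld w) c (fsval u).
Proof. by rewrite field_of_box !tnth_mktuple enum_rankK /= swap_fieldE. Qed.

Lemma measurable_free_energy_field_of T eps B :
  measurable_fun setT (fun y => fe T eps (swap_field a k B (field_of y))).
Proof.
apply: measurable_funM => //; apply: measurableT_comp => //.
apply: measurable_sum => s; apply: measurableT_comp => //.
apply: measurableT_comp => //; apply: measurable_funM => //.
under eq_fun do rewrite hamiltonianE.
apply: measurableT_comp => //; apply: measurable_funD => //.
apply: measurable_sum => u; apply: measurable_funM => //.
under eq_fun do rewrite swap_fieldE field_of_box.
exact: measurable_tnth.
Qed.

Lemma measurable_free_energy T eps B :
  measurable_fun setT (fun w => fe T eps (swap_field a k B (fld w))).
Proof.
rewrite (_ : (fun w => _) = (fun y => fe T eps (swap_field a k B (field_of y)))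
   \o sample X (sites finset.set0)).
  apply: measurableT_comp; first exact: measurable_free_energy_field_of.
  exact: measurable_sample.
apply/funext => w /=; apply: eq_free_energy => c u.
by rewrite !swap_fieldE !field_of_sample !swap_fieldE !inE.
Qed.

Lemma swap_moment T eps t B B' : 0 < T -> 0 <= eps ->
  (\int[P]_w (expR (t * (fe T eps (swap_field a k B (fld w))
                       - fe T eps (swap_field a k B' (fld w)))))%:E
   <= (expR (#|symdiff B B'|%:R * (t * eps) ^+ 2))%:E)%E.
Proof.
move=> T0 eps0; pose Phi B w := fe T eps (swap_field a k B (fld w)).
have mPhi D : measurable_fun setT (Phi D) := measurable_free_energy T eps D.
(* When [a = k] the exchange is trivial and the difference vanishes. *)
have [ak|ak] := eqVneq a k.
  under eq_integral => w _.
    rewrite (@eq_free_energy R d q N a T eps _ (swap_field a k B' (fld w))); last first.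
      by move=> c u; rewrite !swap_fieldE ak tperm1 !perm1 !if_same.
    rewrite subrr mulr0 expR0; over.
  have -> : (\int[P]_w (fun=> 1) w = 1)%E.
    by rewrite integral_cst// mul1e; exact: probability_setT.
  rewrite lee_fin -expR0 ler_expR.
  by rewrite mulr_ge0// sqr_ge0.
pose A := symdiff B B'.
(* The exponent evaluated at the field exchanged on [C]; its exponential moment is the same for all
   [C], by [WE]. *)
pose V w C := t * (Phi (symdiff B C) w - Phi (symdiff B' C) w).
have mV C : measurable_fun setT (V ^~ C).
  by apply: measurable_funM => //; exact: measurable_funB.
pose W C w := expR (V w C).
have mW C : measurable_fun setT (W C) by exact: measurableT_comp.
have WE C : (\int[P]_w (W C w)%:E = \int[P]_w (W finset.set0 w)%:E)%E.
  have [f [mf f0 fE]] : exists f : #|{: 'I_q * box d N}|.-tuple R -> \bar R,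
      [/\ measurable_fun setT f, forall y, (0 <= f y)%E &
        forall C' w, f (sample X (sites C') w) = (W C' w)%:E].
    exists (fun y => (expR (t * (fe T eps (swap_field a k B (field_of y))
      - fe T eps (swap_field a k B' (field_of y)))))%:E); split.
    - apply/measurable_EFinP; apply: measurableT_comp => //; apply: measurable_funM => //.
      by apply: measurable_funB; exact: measurable_free_energy_field_of.
    - by move=> y; rewrite lee_fin expR_ge0.
    - have feE D C' w : fe T eps (swap_field a k D (field_of (sample X (sites C') w)))
          = Phi (symdiff D C') w.
        rewrite /Phi -free_energy_swap_swap; apply: eq_free_energy => c u.
        by rewrite !swap_fieldE field_of_sample swap_fieldE.
      by move=> C' w; rewrite !feE.
  transitivity (\int[P]_w f (sample X (sites C) w))%E.
    by apply: eq_integral => w _; rewrite fE.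
  rewrite (integral_sample iidh (uniq_sites C) (uniq_sites finset.set0) mf f0).
  by apply: eq_integral => w _; rewrite fE.
have -> : (\int[P]_w (expR (t * (Phi B w - Phi B' w)))%:E =
    \int[P]_w (average (enum A) (W ^~ w) finset.set0)%:E)%E.
  rewrite (integral_average (enum A) finset.set0 mW _ WE); last first.
    by move=> C w; exact: expR_ge0.
  by apply: eq_integral => w _; rewrite /W /V !symdiff0.
have uA : uniq (enum A ++ [::]) by rewrite cats0 enum_uniq.
have E := @exp_moment_cosh (t * eps) (enum A) [::] (fun=> true) ak uA.
rewrite addn0 -cardE in E; rewrite -[X in (_ <= X)%E]E.
apply: ge0_le_integral => //.
- by move=> w _; rewrite lee_fin average_ge0// => C; exact: expR_ge0.
- by apply/measurable_EFinP; exact: measurable_average.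
- apply/measurable_EFinP.
  apply: measurable_funM; first exact: measurable_prod_cosh.
  by under eq_fun do rewrite big_nil; exact: measurable_cst.
- move=> w _; rewrite lee_fin big_nil expR0 mulr1.
  pose c (v : box d N) : R := `|t * eps * (h a (fsval v) w - h k (fsval v) w)|.
  have le := @average_expR_le R _ (enum A) (V w) c finset.set0.
  apply: (le_trans (le _)) => [v C _|].
    rewrite /V !symdiff_toggle.
    rewrite mulrB_exchange.
    rewrite /c !normrM (ger0_norm eps0) -mulrA mulrCA ler_wpM2l//.
    rewrite (le_trans (ler_normB _ _))// mulr_natl mulr2n lerD//.
      exact: free_energy_toggle_le.
    exact: free_energy_toggle_le.
  (* A further exchange on all of [A] interchanges the roles of [B] and [B'], so the exponent is odd
     and has mean zero. *)
  rewrite (average_odd (f := V w)); last first.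
    move=> C; rewrite /V -[RHS]mulrN opprB.
    have -> : symdiff B (symdiff A C) = symdiff B' C by rewrite symdiffA symdiffK.
    have -> : symdiff B' (symdiff A C) = symdiff B C.
      by rewrite symdiffA /A [symdiff B B']symdiffC symdiffK.
    by [].
  by rewrite expR0 mul1r; apply: ler_prod => v _; rewrite cosh_ge0 /c cosh_abs lexx.
Qed.

End SwapMoment.

(** * Chaining over the scales *)

Section UnionBound.
Context {R : realType} {d} {Om : measurableType d} (P : probability Om R).

Definition small_event (E : set Om) (b : R) := measurable E /\ (P E <= b%:E)%E.

Lemma small_event_bigsetU (I : Type) (s : seq I) (p : pred I) (E : I -> set Om) (b : I -> R) :
  (forall x, p x -> small_event (E x) (b x)) ->
  small_event (\big[setU/set0]_(x <- s | p x) E x) (\sum_(x <- s | p x) b x).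
Proof.
move=> sE; elim: s => [|x s IH].
  by rewrite !big_nil; split; [exact: measurable0|rewrite measure0].
rewrite !big_cons; case: ifP => // px.
have [mE Eb] := sE x px; have [mU Ub] := IH; split; first exact: measurableU.
by apply: (le_trans (measureU2 _ mE mU)); rewrite EFinD leeD.
Qed.

Lemma notin_bigsetU (I : eqType) (s : seq I) (p : pred I) (E : I -> set Om) w x :
  ~ (\big[setU/set0]_(x <- s | p x) E x) w -> x \in s -> p x -> ~ E x w.
Proof.
elim: s => // y s IH; rewrite big_cons inE => nw /orP[/eqP-> px|xs px].
  by move: nw; rewrite px => nw Ew; apply: nw; left.
apply: IH => // Uw; apply: nw; case: ifP => // _; first by right.
Qed.

End UnionBound.

Section SwapTail.
Context {R : realType} {d q N : nat} {dsp} {Om : measurableType dsp}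
  (P : probability Om R) (h : 'I_q -> 'rV[int]_d -> {RV P >-> R})
  (iidh : iid_standard_gaussian (fun kv : 'I_q * 'rV[int]_d => h kv.1 kv.2))
  (a k : 'I_q).
Implicit Types (B : {set box d N}).
Local Notation fe := (@free_energy R d q N a).

Lemma swap_tail (T eps lambda n : R) B B' : 0 < T -> 0 < eps -> 0 < lambda -> 0 < n ->
  #|symdiff B B'|%:R <= n ->
  small_event P
    [set w | lambda <= fe T eps (swap_field a k B (fun c v => h c v w))
              - fe T eps (swap_field a k B' (fun c v => h c v w))]
    (expR (- (lambda ^+ 2 / (4 * eps ^+ 2 * n)))).
Proof.
move=> T0 eps0 l0 n0 Bn.
pose Phi B w := fe T eps (swap_field a k B (fun c v => h c v w)).
have mPhi D : measurable_fun setT (Phi D) := measurable_free_energy h a k T eps D.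
have mX : measurable_fun setT (fun w => Phi B w - Phi B' w) by exact: measurable_funB.
pose X : {RV P >-> R} := HB.pack (fun w => Phi B w - Phi B' w)
  (isMeasurableFun.Build _ _ _ _ _ mX).
split.
  have := mX measurableT _ (measurable_itv `[lambda, +oo[); rewrite setTI.
  congr measurable; apply/seteqP; split => w /=; by rewrite in_itv/= andbT.
(* The minimiser of the Chernoff exponent [n * (t * eps) ^+ 2 - t * lambda]. *)
pose t := lambda / (2 * eps ^+ 2 * n).
have t0 : 0 < t by rewrite divr_gt0// !mulr_gt0// exprn_gt0.
apply: (le_trans (chernoff X lambda t0)).
have -> : expR (- (lambda ^+ 2 / (4 * eps ^+ 2 * n))) =
    expR (n * (t * eps) ^+ 2) * expR (- (t * lambda)).
  rewrite -expRD /t; congr expR; field.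
  by rewrite !gt_eqF.
rewrite EFinM lee_wpmul2r ?lee_fin ?expR_ge0//.
have := swap_moment iidh a k t B B' T0 (ltW eps0) => M.
apply: (@le_trans _ _ (expR (#|symdiff B B'|%:R * (t * eps) ^+ 2))%:E).
  apply: le_trans M; rewrite /mmt_gen_fun unlock le_eqVlt; apply/orP; left; apply/eqP.
  by apply: eq_integral => w _; rewrite /= mulrC.
by rewrite lee_fin ler_expR ler_wpM2r// sqr_ge0.
Qed.

End SwapTail.

(** * The chain of traces of a contour *)

Section Chaining.
Context {R : realType} {d q N : nat} (a : 'I_q) (i j : 'I_d).
Implicit Types (B : {set box d N}) (m n : nat).

(** A predecessor, because the grids have mesh [l.+1]; the mesh is thus [16 ^ n]. *)
Definition scale n : nat := (16 ^ n).-1.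

Lemma scaleS n : (scale n).+1 = (16 ^ n)%N.
Proof. by rewrite /scale prednK// expn_gt0. Qed.

Definition trace n m (c : @code d (scale n) m) : {set box d N} :=
  [set u | decode i c (fsval u)]%SET.

Lemma card_symdiff_triangle (V : finType) (A B C : {set V}) :
  (#|symdiff A B| <= #|symdiff C A| + #|symdiff C B|)%N.
Proof.
apply: (@leq_trans #|symdiff C A :|: symdiff C B|%SET).
  apply/subset_leq_card/fintype.subsetP => v; rewrite finset.in_setU !in_symdiff.
  by case: (v \in A); case: (v \in B); case: (v \in C).
by rewrite cardsU leq_subr.
Qed.

Lemma coarse_contour A n : (3 <= d)%N -> i != j -> is_contour N A ->
  exists c : @code d (scale n) (perimeter A),
    (#|symdiff (interior N A) (trace c)| <= 4 * scale n * perimeter A)%N /\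
    ((2 * perimeter A < 256 ^ n)%N -> trace c = finset.set0).
Proof.
move=> d3 ij [A0 cA AN].
have uU : uniq [seq fsval u | u : box d N].
  by rewrite map_inj_uniq ?enum_uniq//; exact: val_inj.
have [c [cle c0]] := coarse_graining (l := scale n) d3 ij A0 cA uU; exists c; split.
  apply: leq_trans cle; rewrite count_map cardE -size_filter.
  apply: uniq_leq_size (enum_uniq _) _ => u.
  rewrite mem_enum in_symdiff => uS; rewrite mem_filter mem_enum andbT /=.
  by move: uS; rewrite !inE; case: (fsval u \in A); case: (decode _ _ _).
move=> mn; apply/setP => u; rewrite !inE; apply: c0.
by rewrite scaleS -expnM [(n * 2)%N]mulnC expnM.
Qed.

(** The traces at scales [n] and [n.+1] each differ from the interior by at most 4 times perimeter
    times mesh, and [68 = 4 + 4 * 16]. The allowances form a geometric series with sum at most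
    [m / (2 q)]. *)
Definition chain_bounded (Phi : {set box d N} -> R) m : Prop :=
  forall n, (n < m.+1)%N -> (256 ^ n <= 2 * m)%N ->
  forall (c : @code d (scale n) m) (c' : @code d (scale n.+1) m),
    (#|symdiff (trace c) (trace c')| <= 68 * (m * 16 ^ n))%N ->
    Phi (trace c) - Phi (trace c') <= m%:R / (4 * q%:R * 2 ^+ n).

(** The difference telescopes over the scales, from the interior at scale 0 to the empty set at
    scale [m.+1]. Where [2 m < 256 ^ n], both ends of the link are already empty. *)
Lemma chaining (Phi : {set box d N} -> R) A : (3 <= d)%N -> i != j -> is_contour N A ->
  chain_bounded Phi (perimeter A) ->
  Phi (interior N A) - Phi finset.set0 <= (perimeter A)%:R / (2 * q%:R).
Proof.
move=> d3 ij cA good; set m := perimeter A in good *.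
have q0 : 0 < q%:R :> R by rewrite ltr0n (leq_ltn_trans _ (ltn_ord a)).
have /(_ _)/cid-/all_sig[c cP] := fun n => coarse_contour n d3 ij cA.
pose B n := trace (c n).
have B0 : B 0%N = interior N A.
  have [+ _] := cP 0%N; rewrite muln0 mul0n leqn0 cards_eq0 => /eqP E.
  by rewrite -[LHS](symdiffK (interior N A)) E symdiff0.
have BJ : B m.+1 = finset.set0.
  have [_ E] := cP m.+1; rewrite /B E// -/m (@leq_trans (2 ^ m.+1))//.
    by rewrite expnS ltn_mul2l/= ltn_expl.
  by rewrite leq_exp2r.
have step n : (n < m.+1)%N -> Phi (B n) - Phi (B n.+1) <= m%:R / (4 * q%:R * 2 ^+ n).
  move=> nm; have [le|lt] := leqP (256 ^ n) (2 * m).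
    apply: good => //; have [b1 _] := cP n; have [b2 _] := cP n.+1.
    apply: (leq_trans (card_symdiff_triangle _ _ (interior N A))).
    apply: (leq_trans (leq_add b1 b2)); rewrite -/m.
    have := scaleS n; have := scaleS n.+1; rewrite expnS.
    move: (scale n) (scale n.+1) (16 ^ n)%N => x y z E1 E2; nia.
  have [_ E] := cP n; have [_ E'] := cP n.+1; rewrite /B E// E'.
    by rewrite subrr divr_ge0// !mulr_ge0// ?ltW// exprn_ge0.
  by rewrite (ltn_trans lt)// ltn_exp2l.
rewrite -B0 -BJ.
have -> : Phi (B 0%N) - Phi (B m.+1) = \sum_(n < m.+1) (Phi (B n) - Phi (B n.+1)).
  rewrite -(big_mkord xpredT (fun n => Phi (B n) - Phi (B n.+1))).
  by rewrite (telescope_sumr_eq (fun n => - Phi (B n)))// => [|n _]; rewrite ?opprK addrC.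
apply: (@le_trans _ _ (\sum_(n < m.+1) m%:R / (4 * q%:R * 2 ^+ n))).
  by apply: ler_sum => n _; exact: step.
have -> : \sum_(n < m.+1) m%:R / (4 * q%:R * 2 ^+ n) =
    m%:R / (2 * q%:R) * (1 - 2 ^- m.+1) :> R.
  elim: m.+1 => [|n IH]; first by rewrite big_ord0 expr0 invr1 subrr mulr0.
  rewrite big_ord_recr/= IH exprS; field.
  by rewrite expf_neq0//= gt_eqF.
apply: ler_piMr; first by rewrite divr_ge0// mulr_ge0// ltW.
by rewrite lerBlDr lerDl invr_ge0 exprn_ge0.
Qed.

End Chaining.

(** * Counting the codes *)

Section CodeCount.
Context {R : realType}.

Lemma two_le_expR1 : 2 <= expR 1 :> R.
Proof. by have := expR_ge1Dx (1 : R); lra. Qed.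

Lemma pow2_le_expR n : (2 ^ n)%:R <= expR n%:R :> R.
Proof.
elim: n => [|n IH]; first by rewrite expn0 expR0.
rewrite expnS natrM (_ : n.+1%:R = 1 + n%:R); last by rewrite addrC natr1.
by rewrite expRD ler_pM// two_le_expR1.
Qed.

Lemma expn_sqr_scale n : ((16 ^ n) ^ 2 = 2 ^ (8 * n))%N.
Proof. by rewrite -[16%N]/(2 ^ 4)%N -!expnM; congr expn; clear; lia. Qed.

(* The cost in entropy of a link at scale [16 ^ n] of a contour of perimeter [m],
   in units of [m / 64 ^ n]. *)
Definition entropy_rate (d : nat) : R := (25 + 74 * d)%:R.

(** Word lengths are of order [v], and [u = 4 ^ n * v]. The factor [4 ^ n >= n.+1] absorbs the
    logarithm of the alphabet size, which is linear in [n]. *)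
Lemma scale_bounds n m : (256 ^ n <= 2 * m)%N ->
  let u : R := m%:R / 64 ^+ n in let v : R := m%:R / 256 ^+ n in
  [/\ 2^-1 <= v <= u, v * n.+1%:R <= u, n.+1%:R <= 2 * u & m.+1%:R <= expR (19 * u)].
Proof.
move=> le u v.
have p64 : 0 < 64 ^+ n :> R by rewrite exprn_gt0// ltr0n.
have p256 : 0 < 256 ^+ n :> R by rewrite exprn_gt0// ltr0n.
have p4 : 0 < 4 ^+ n :> R by rewrite exprn_gt0// ltr0n.
have uv : u = v * 4 ^+ n.
  rewrite /u /v (_ : 256 = 64 * 4); last by ring.
  rewrite exprMn; field; by rewrite !gt_eqF.
have v12 : 2^-1 <= v.
  rewrite /v ler_pdivlMr// mulrC ler_pdivrMr//.
  by rewrite -natrX -natrM ler_nat mulnC.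
have n4 : n.+1%:R <= 4 ^+ n :> R by rewrite -natrX ler_nat ltn_expl.
have v0 : 0 <= v by lra.
have vu : v <= u by rewrite uv ler_peMr// (le_trans _ n4)// ler1n.
have vn : v * n.+1%:R <= u by rewrite uv ler_wpM2l.
have nu : n.+1%:R <= 2 * u.
  by apply: (le_trans n4); rewrite uv mulrA; apply: ler_peMl; [exact: ltW|lra].
split => //; first by rewrite v12.
have m2 : (m.+1 <= 2 * m)%N.
  have : (0 < 256 ^ n)%N by rewrite expn_gt0.
  by clear -le; move: (256 ^ n)%N le => x; lia.
apply: (@le_trans _ _ (expR 1 * (expR v * expR (8 * n)%:R))); last first.
  rewrite -!expRD ler_expR natrM; rewrite -natr1 in nu.
  by have : 0 <= n%:R :> R by []; lra.
apply: (@le_trans _ _ (2 * m%:R)); first by rewrite -natrM ler_nat.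
have -> : m%:R = v * (2 ^ (8 * n))%:R :> R.
  by rewrite expnM natrX /v divfK ?gt_eqF.
rewrite ler_pM ?two_le_expR1 ?mulr_ge0// ler_pM ?pow2_le_expR//.
by have := expR_ge1Dx v; lra.
Qed.

(** The starting position costs [19 u], the translate [8 d u], and the word [(6 + 66 d) u], being at
    most [6 v] letters long. The total is [entropy_rate d * u]. *)
Lemma card_code_le d n n' m : (256 ^ n <= 2 * m)%N -> (n <= n' <= n.+1)%N ->
  #|{: @code d (scale n') m}|%:R <= expR (entropy_rate d * (m%:R / 64 ^+ n)) :> R.
Proof.
move=> le nn'; have := scale_bounds le.
set u : R := m%:R / 64 ^+ n; set v : R := m%:R / 256 ^+ n => -[/andP[v12 vu] vn nu F1].
have p256 : 0 < 256 ^+ n :> R by rewrite exprn_gt0// ltr0n.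
have v0 : 0 <= v by lra.
have u0 : 0 <= u by exact: le_trans vu.
have n1 : 1 <= n.+1%:R :> R by rewrite ler1n.
have dE : 0 <= d%:R :> R by [].
rewrite card_code !natrM scaleS.
have F2 : ((16 ^ n') ^ d)%:R <= expR (8 * d%:R * u) :> R.
  rewrite (_ : ((16 ^ n') ^ d = 2 ^ (4 * n' * d))%N); last by rewrite !expnM.
  apply: (le_trans (pow2_le_expR _)); rewrite ler_expR !natrM.
  have : n'%:R <= n.+1%:R :> R by rewrite ler_nat; case/andP: nn'.
  nra.
have F3 : ((2 * (4 * (16 ^ n') ^ 2).+1 ^ d) ^ (6 * m %/ (16 ^ n') ^ 2))%:R
    <= expR ((6 + 66 * d%:R) * u) :> R.
  set e := (6 * m %/ _)%N.
  have ee : e%:R <= 6 * v.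
    rewrite /v mulrA ler_pdivlMr// -natrX -!natrM ler_nat.
    apply: leq_trans (leq_trunc_div (6 * m) ((16 ^ n') ^ 2)).
    rewrite leq_mul2l -expnM mulnC expnM (_ : (16 ^ 2 = 256)%N)// leq_exp2l//.
    by case/andP: nn' => ->; rewrite orbT.
  apply: (@le_trans _ _ (2 ^ ((1 + (3 + 8 * n.+1) * d) * e))%:R).
    rewrite ler_nat expnM; case: (posnP e) => [->|e0]; first by rewrite !expn0.
    rewrite leq_exp2r// expnD expn1 leq_mul2l/= expnM.
    case: (posnP d) => [->|d0]; first by rewrite !expn0.
    rewrite leq_exp2r// expnD; have : ((16 ^ n') ^ 2 <= 2 ^ (8 * n.+1))%N.
      by rewrite expn_sqr_scale leq_exp2l// leq_mul2l; case/andP: nn'.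
    have : (0 < (16 ^ n') ^ 2)%N by rewrite !expn_gt0.
    clear; move: ((16 ^ n') ^ 2)%N (2 ^ (8 * n.+1))%N => x y; rewrite -[(2 ^ 3)%N]/8%N; lia.
  apply: (le_trans (pow2_le_expR _)); rewrite ler_expR natrM natrD natrM natrD natrM.
  apply: (@le_trans _ _ ((1 + (3 + 8 * n.+1%:R) * d%:R) * (6 * v))).
    by rewrite ler_wpM2l// addr_ge0// mulr_ge0// addr_ge0// mulr_ge0.
  have := mulr_ge0 dE (_ : 0 <= u - v * n.+1%:R); have := mulr_ge0 dE (_ : 0 <= u - v).
  rewrite !subr_ge0 => /(_ vu) h1 /(_ vn) h2; nra.
rewrite (_ : entropy_rate d * u = 19 * u + 8 * d%:R * u + (6 + 66 * d%:R) * u); last first.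
  by rewrite /entropy_rate natrD natrM; ring.
by rewrite !expRD ler_pM// ler_pM.
Qed.

End CodeCount.

Section NumericSums.
Context {R : realType}.

Lemma sum_inv_sqr_le1 M : \sum_(1 <= m < M) (m.+1%:R ^- 2 : R) <= 1.
Proof.
have [|M1] := leqP M 1; first by move=> M1; rewrite big_geq.
(* The stronger bound telescopes and so goes through the induction. *)
suff : \sum_(1 <= m < M) (m.+1%:R ^- 2 : R) <= 1 - M%:R^-1.
  by move=> le; apply: (le_trans le); rewrite lerBlDr lerDl invr_ge0.
case: M M1 => // M M1; elim: M M1 => // -[|M] IH _.
  by rewrite big_nat1; lra.
rewrite big_nat_recr//=; apply: (le_trans (lerD (IH isT) (lexx _))).
have -> : M.+3%:R = M.+2%:R + 1 :> R by rewrite natr1.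
have : 0 < M.+2%:R :> R by rewrite ltr0n.
move: (M.+2%:R) => x x0.
rewrite -subr_ge0 (_ : _ - _ = (x * (x + 1) ^+ 2)^-1); last first.
  by field; rewrite !gt_eqF// addr_gt0.
by rewrite invr_ge0 mulr_ge0// ?sqr_ge0 ?ltW.
Qed.

End NumericSums.

(** * The union bound over the links of all chains *)

Section ChainEvent.
Context {R : realType}.

Lemma sum_const_le (I : finType) (p : pred I) (x : R) : 0 <= x ->
  \sum_(i | p i) x <= #|{: I}|%:R * x.
Proof.
move=> x0; rewrite big_mkcond mulr_natl -sumr_const.
by apply: ler_sum => i _; case: ifP.
Qed.

(** The choices of a colour and of the two codes of a link, times its Gaussian tail. *)
Definition link_cost (d q m n : nat) (t : R) : R :=
  q%:R * (#|{: @code d (scale n) m}|%:R *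
  (#|{: @code d (scale n.+1) m}|%:R * expR (- (t * (m%:R / 64 ^+ n))))).

(* Since [expR (19 u) >= m.+1] for [u = m / 64 ^ n], an extra [57 u] in the exponent
   pays for the power [m.+1 ^- 3]. *)
Lemma link_cost_le d q m n t : (256 ^ n <= 2 * m)%N ->
  2 * (2 * entropy_rate d + 57) <= t ->
  link_cost d q m n t <= q%:R * expR (- (t / 4)) * (m.+1%:R ^- 3).
Proof.
move=> le Kt; have := scale_bounds (R := R) le.
rewrite /link_cost; set K := entropy_rate d in Kt *; set u : R := m%:R / 64 ^+ n.
move=> [/andP[v12 vu] _ _ F]; have u12 := le_trans v12 vu.
rewrite -mulrA ler_wpM2l//.
have c1 := card_code_le d le (_ : (n <= n <= n.+1)%N).
have c2 := card_code_le d le (_ : (n <= n.+1 <= n.+1)%N).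
apply: (@le_trans _ _ (expR (K * u) * (expR (K * u) * expR (- (t * u))))).
  rewrite ler_pM// ?mulr_ge0 ?expR_ge0//; first by apply: c1; rewrite leqnn leqnSn.
  rewrite ler_wpM2r ?expR_ge0//; apply: c2; by rewrite leqnSn leqnn.
have m0 : 0 < m.+1%:R :> R by rewrite ltr0n.
apply: (@le_trans _ _ (expR (- (t / 4)) * expR (- (57 * u)))).
  rewrite -!expRD ler_expR.
  have tu : 0 <= (t - 2 * (2 * K + 57)) * (u - 2^-1) by rewrite mulr_ge0// subr_ge0.
  have K0 : 0 <= K by [].
  have := mulr_ge0 K0 (_ : 0 <= u - 2^-1); rewrite subr_ge0 => /(_ u12); nra.
rewrite ler_wpM2l ?expR_ge0// expRN lef_pV2 ?posrE ?expR_gt0 ?exprn_gt0//.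
rewrite (_ : 57 * u = 3%:R * (19 * u)); last by ring.
by rewrite expRM_natl lerXn2r ?nnegrE ?expR_ge0.
Qed.

(** The at most [m.+1] scales use up one power of [m.+1 ^- 3], and the remaining sum over [m] is at
    most 1. The factor [q] is absorbed by [expR (t / 8)]. *)
Lemma sum_link_cost_le d q M t : 2 * (2 * entropy_rate d + 57) <= t -> 8 * q%:R <= t ->
  \sum_(1 <= m < M) \sum_(n < m.+1 | (256 ^ n <= 2 * m)%N) link_cost d q m n t
  <= expR (- (t / 8)).
Proof.
move=> Kt qt.
apply: (@le_trans _ _ (\sum_(1 <= m < M) (q%:R * expR (- (t / 4)) * m.+1%:R ^- 2))).
  apply: ler_sum => m _.
  apply: (@le_trans _ _ (\sum_(n < m.+1 | (256 ^ n <= 2 * m)%N)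
      (q%:R * expR (- (t / 4)) * (m.+1%:R ^- 3)))).
    by apply: ler_sum => n /link_cost_le; apply.
  apply: le_trans (sum_const_le _ _) _.
    by rewrite mulr_ge0 ?mulr_ge0 ?expR_ge0// invr_ge0 exprn_ge0.
  rewrite card_ord mulrCA ler_wpM2l ?mulr_ge0 ?expR_ge0//.
  by rewrite exprS invfM mulrA divff ?mul1r// pnatr_eq0.
rewrite -mulr_sumr; apply: le_trans (ler_wpM2l _ (sum_inv_sqr_le1 M)) _.
  by rewrite mulr_ge0 ?expR_ge0.
rewrite mulr1; apply: (@le_trans _ _ (expR q%:R * expR (- (t / 4)))).
  rewrite ler_wpM2r ?expR_ge0//; have := expR_ge1Dx (q%:R : R); lra.
by rewrite -expRD ler_expR; lra.
Qed.

Context {d q N : nat} {dsp} {Om : measurableType dsp} (P : probability Om R)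
  (h : 'I_q -> 'rV[int]_d -> {RV P >-> R})
  (iidh : iid_standard_gaussian (fun kv : 'I_q * 'rV[int]_d => h kv.1 kv.2))
  (a : 'I_q) (i : 'I_d).

Local Notation Phi T eps k w := (fun B : {set box d N} =>
  free_energy (N := N) a T eps (swap_field a k B (fun c v => h c v w))).

(* The links deviate by [lambda = m / (4 q 2 ^ n)] on at most [b = 68 m 16 ^ n] sites,
   and [lambda ^ 2 / (4 eps ^ 2 b) = t m / 64 ^ n] since [4352 = 16 * 4 * 68]. *)
Lemma chain_event (T eps : R) M : 0 < T -> 0 < eps ->
  let t := (4352 * q%:R ^+ 2 * eps ^+ 2)^-1 in
  exists E : set Om, small_event P E
    (\sum_(1 <= m < M) \sum_(n < m.+1 | (256 ^ n <= 2 * m)%N) link_cost d q m n t) /\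
  forall w, ~ E w -> forall k m, (0 < m < M)%N ->
    chain_bounded (q := q) i (Phi T eps k w) m.
Proof.
move=> T0 eps0 t.
have q0 : 0 < q%:R :> R by rewrite ltr0n (leq_ltn_trans _ (ltn_ord a)).
pose F m n k (c : @code d (scale n) m) (c' : @code d (scale n.+1) m) :=
  [set w | m%:R / (4 * q%:R * 2 ^+ n) <=
    Phi T eps k w (trace i c) - Phi T eps k w (trace i c')].
pose near m n (c : @code d (scale n) m) (c' : @code d (scale n.+1) m) :=
  (#|symdiff (trace (N := N) i c) (trace i c')| <= 68 * (m * 16 ^ n))%N.
exists (\big[setU/set0]_(1 <= m < M) \big[setU/set0]_(n < m.+1 | (256 ^ n <= 2 * m)%N)
  \big[setU/set0]_(k : 'I_q) \big[setU/set0]_(c : @code d (scale n) m)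
  \big[setU/set0]_(c' | @near m n c c') F m n k c c').
split; last first.
  move=> w nE k m mM n nm le c c' cc'.
  have {}nE := notin_bigsetU nE (_ : m \in _) isT.
  have {}nE := notin_bigsetU (nE _) (mem_index_enum (Ordinal nm)) le.
  have {}nE := notin_bigsetU (nE _) (mem_index_enum k) isT.
  have {}nE := notin_bigsetU (nE _) (mem_index_enum c) isT.
  have {}nE := notin_bigsetU (nE _) (mem_index_enum c') cc'.
  have : ~ F m n k c c' w by apply: nE; rewrite mem_index_iota.
  by move=> /negP; rewrite -ltNge => /ltW.
rewrite big_nat_cond [X in small_event _ _ X]big_nat_cond.
apply: small_event_bigsetU => m; rewrite andbT => /andP[m0 _].
apply: small_event_bigsetU => n le.
have E0 c c' : near m n c c' -> forall k,
    small_event P (F m n k c c') (expR (- (t * (m%:R / 64 ^+ n)))).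
  move=> cc' k.
  have mR : 0 < m%:R :> R by rewrite ltr0n.
  have p2 : 0 < 2 ^+ n :> R by rewrite exprn_gt0.
  have p16 : 0 < 16 ^+ n :> R by rewrite exprn_gt0.
  have := @swap_tail _ _ _ N _ _ _ _ iidh a k T eps (m%:R / (4 * q%:R * 2 ^+ n))
    (68 * (m%:R * 16 ^+ n)) (trace i c) (trace i c') T0 eps0.
  rewrite divr_gt0 ?mulr_gt0// => /(_ isT isT).
  rewrite -natrX -!natrM ler_nat => /(_ cc').
  rewrite !natrM natrX => -[mF le1]; split; first exact: mF.
  suff -> : t * (m%:R / 64 ^+ n) = (m%:R / (4 * q%:R * 2 ^+ n)) ^+ 2 /
    (4 * eps ^+ 2 * (68 * (m%:R * 16 ^+ n))) by exact: le1.
  rewrite (_ : 64 ^+ n = 2 ^+ n * 2 ^+ n * 16 ^+ n) /t; last first.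
    by rewrite -!exprMn; congr (_ ^+ n); ring.
  by field; rewrite !gt_eqF.
have e0 : 0 <= expR (- (t * (m%:R / 64 ^+ n))) :> R by exact: expR_ge0.
have small_le E (b b' : R) : small_event P E b -> b <= b' -> small_event P E b'.
  by move=> [mE Eb] bb'; split => //; apply: (le_trans Eb); rewrite lee_fin.
apply: small_le.
  apply: small_event_bigsetU => k _; apply: small_event_bigsetU => c _.
  apply: small_event_bigsetU => c' cc'; exact: E0.
rewrite /link_cost; apply: le_trans (ler_sum _ _) _ => [k _|].
  apply: (le_trans (ler_sum _ _)) => [c _|]; first exact: sum_const_le.
  by apply: sum_const_le; rewrite mulr_ge0.
by apply: le_trans (sum_const_le _ _) _; rewrite ?mulr_ge0// card_ord.
Qed.

End ChainEvent.

(** * The Gibbs estimate at positive temperature *)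

Section LowTemperature.
Context {R : realType} {d q N : nat} (a : 'I_q) (i j : 'I_d).
Hypotheses (d3 : (3 <= d)%N) (ij : i != j).
Implicit Types (T eps : R) (h : 'I_q -> 'rV[int]_d -> R).

Lemma peierls_sum_le T : 0 < T ->
  2 * (entropy_rate d + 2) <= (2 * q%:R * T)^-1 -> 4 * q%:R <= (2 * q%:R * T)^-1 ->
  peierls_sum (d := d) (q := q) (N := N) T <= expR (- ((2 * q%:R * T)^-1 / 4)).
Proof.
move=> T0; set t := (2 * q%:R * T)^-1; set K := entropy_rate d => Kt qt.
apply: (@le_trans _ _ (\sum_(1 <= m < max_perimeter (d := d) (N := N))
    (q%:R * expR (- (t / 2)) * m.+1%:R ^- 2))).
  rewrite /peierls_sum big_nat_cond [X in _ <= X]big_nat_cond.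
  apply: ler_sum => m; rewrite andbT => /andP[m0 _].
  have m1 : 1 <= m%:R :> R by rewrite ler1n.
  have c := card_code_le (R := R) d (_ : (256 ^ 0 <= 2 * m)%N) (_ : (0 <= 0 <= 1)%N).
  rewrite natrM [X in X * _]mulrC -(mulrA q%:R) -(mulrA q%:R) ler_wpM2l//.
  apply: (@le_trans _ _ (expR (K * m%:R) * expR (- (m%:R * t)))).
    rewrite /t ler_wpM2r ?expR_ge0//; move: c; rewrite expr0 divr1; apply => //.
    by rewrite expn0; clear -m0; lia.
  (* The part [expR (- 2 m)] is kept to pay for [m.+1 ^- 2], as [m.+1 <= expR m]. *)
  apply: (@le_trans _ _ (expR (- (t / 2)) * expR (- (2%:R * m%:R)))).
    rewrite -!expRD ler_expR.
    have := mulr_ge0 (_ : 0 <= t - 2 * (K + 2)) (_ : 0 <= m%:R - 1).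
    rewrite !subr_ge0 => /(_ Kt m1).
    have K0 : 0 <= K by [].
    have := mulr_ge0 K0 (_ : 0 <= m%:R - 1); rewrite subr_ge0 => /(_ m1); nra.
  rewrite ler_wpM2l ?expR_ge0// expRN lef_pV2 ?posrE ?expR_gt0 ?exprn_gt0//.
  rewrite expRM_natl lerXn2r ?nnegrE ?expR_ge0//.
  by rewrite -natr1 addrC expR_ge1Dx.
rewrite -mulr_sumr; apply: le_trans (ler_wpM2l _ (sum_inv_sqr_le1 _)) _.
  by rewrite mulr_ge0 ?expR_ge0.
rewrite mulr1; apply: (@le_trans _ _ (expR q%:R * expR (- (t / 2)))).
  rewrite ler_wpM2r ?expR_ge0//; have := expR_ge1Dx (q%:R : R); lra.
by rewrite -expRD ler_expR; lra.
Qed.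

(** Exponentiating the bound [m / (2 q)] of [chaining] on the free energies gives the hypothesis of
    [peierls_bound]. *)
Lemma gibbs_chain_bounded T eps h : 0 < T ->
  (forall k m, (0 < m < max_perimeter (d := d) (N := N))%N ->
    chain_bounded (q := q) i
      (fun B : {set box d N} => free_energy (N := N) a T eps (swap_field a k B h)) m) ->
  1 - peierls_sum (d := d) (q := q) (N := N) T
    <= potts_gibbs a T eps h [set s : config d q N | s (origin d N) == a]%SET.
Proof.
move=> T0 good; apply: (peierls_bound d3 ij T0) => A k cA.
have [A0 _ AN] := cA.
have := chaining a d3 ij cA (good k _ _); rewrite perimeter_gt0//= => /(_ (perimeter_lt AN)).
rewrite (@eq_free_energy _ _ _ _ _ _ _ (swap_field a k finset.set0 h) h); last first.
  by move=> c u; rewrite swap_fieldE finset.in_set0.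
have Z0 := partition_function_gt0 (N := N) a T eps.
rewrite /free_energy -mulrBr -ln_div ?posrE// => le.
rewrite -ler_pdivrMr// -ler_ln ?posrE ?expR_gt0 ?divr_gt0// expRK.
by rewrite invfM mulrA ler_pdivlMr// mulrC.
Qed.

Lemma gibbs_no_field T h : 0 < T ->
  1 - peierls_sum (d := d) (q := q) (N := N) T
    <= potts_gibbs a T 0 h [set s : config d q N | s (origin d N) == a]%SET.
Proof.
move=> T0; apply: (peierls_bound d3 ij T0) => A k _.
rewrite (_ : partition_function a T 0 _ = partition_function (N := N) a T 0 h).
  rewrite ler_peMl ?(ltW (partition_function_gt0 _ _ _ _))// -expR0 ler_expR.
  by rewrite divr_ge0// !mulr_ge0// ltW.
rewrite /partition_function; apply: eq_bigr => s _; rewrite !hamiltonianE.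
by congr (expR (- (_ * - (_ + _)))); apply: eq_bigr => u _; rewrite !mul0r.
Qed.

End LowTemperature.

(** * Long-range order *)

Section LimitEvents.
Context {R : realType} {dsp} {Om : measurableType dsp} (P : probability Om R).

Lemma measurable_ge (f : Om -> R) (p : R) : measurable_fun setT f ->
  measurable [set w | p <= f w].
Proof.
move=> mf; have := mf measurableT _ (measurable_itv `[p, +oo[); rewrite setTI.
by congr measurable; apply/seteqP; split => w /=; rewrite in_itv/= andbT.
Qed.

(** The events occur infinitely often with probability at least the limit of [p_], and wherever they
    do, [p <= g] follows in the limit. *)
Lemma limit_event (g_ : nat -> Om -> R) (g : Om -> R) (p_ : nat -> R) (p : R) :
  (forall n, measurable_fun setT (g_ n)) ->
  (forall w, g_ n w @[n --> \oo] --> g w) -> p_ n @[n --> \oo] --> p ->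
  (forall n, ((p_ n)%:E <= P [set w | (p_ n <= g_ n w)%R])%E) ->
  (p%:E <= P [set w | (p <= g w)%R])%E.
Proof.
move=> mg gg pp le; pose G n := [set w | p_ n <= g_ n w].
have mG n : measurable (G n) by exact: measurable_ge.
have mU n : measurable (\bigcup_(k >= n) G k) by exact: bigcup_measurable.
have cU := @lim_sup_set_cvg _ _ _ P _ mG (le_lt_trans (probability_le1 P (mU 0%N)) (ltry 1)).
apply: (@le_trans _ _ (P (lim_sup_set G))).
  apply: (@lee_cvg_to _ _ _ _ (fun n => (p_ n)%:E) _ _ _ _ cU).
    by apply: cvg_EFin => //; exact: nearW.
  apply: nearW => n; apply: (le_trans (le n)); apply: le_measure; rewrite ?inE//.
    exact: mG.
  by move=> w Gw; exists n => /=.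
apply: le_measure; rewrite ?inE//.
- exact: bigcap_measurable.
- by apply: measurable_ge; apply: (measurable_fun_cvg mg) => w _; exact: gg.
move=> w Lw; rewrite /= leNgt; apply/negP => gp.
have : \forall n \near \oo, g_ n w < p_ n.
  have : (p_ n - g_ n w) @[n --> \oo] --> p - g w by apply: cvgB => //; exact: gg.
  move=> /cvgr_gt => /(_ 0); rewrite subr_gt0 => /(_ gp).
  by apply: filterS => n; rewrite subr_gt0.
move=> [n _ nP]; have [k /= nk] := Lw n I.
by rewrite /G /= leNgt nP.
Qed.

End LimitEvents.

Section MeasurableGibbs.
Context {R : realType} {d q N : nat} {dsp} {Om : measurableType dsp}
  (P : probability Om R) (h : 'I_q -> 'rV[int]_d -> {RV P >-> R}) (a : 'I_q).

Lemma measurable_gibbs T eps (A : {set config d q N}) : T != 0 ->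
  measurable_fun setT (fun w => potts_gibbs a T eps (fun k v => h k v w) A).
Proof.
move=> T0; pose H s w := hamiltonian a eps (fun k v => h k v w) (s : config d q N).
have mE s : measurable_fun setT (fun w => - (T^-1 * H s w)).
  apply: measurableT_comp => //; apply: measurable_funM => //.
  rewrite /H; under eq_fun do rewrite hamiltonianE.
  apply: measurableT_comp => //; apply: measurable_funD => //.
  apply: measurable_sum => u; apply: measurable_funM => //; exact: measurable_funP.
(* Written as an exponential of a difference, the quotient is measurable through [expR] and [ln]. *)
rewrite (_ : (fun w => _) = fun w => \sum_(s in A) expR (- (T^-1 * H s w)
    - ln (\sum_s' expR (- (T^-1 * H s' w))))); last first.
  apply/funext => w; apply: eq_bigr => s _; rewrite /gibbs_pmf (negbTE T0) expRB lnK//.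
  by rewrite posrE; exact: partition_function_gt0.
under eq_fun do rewrite big_mkcond; apply: measurable_sum => s.
case: (s \in A) => //; apply: measurableT_comp => //; apply: measurable_funB => //.
apply: measurableT_comp => //; apply: measurable_sum => s'; exact: measurableT_comp.
Qed.

End MeasurableGibbs.

(** * Choice of the constant *)

Section Main.
Context {R : realType} (d q : nat).

(** The sum of the two thresholds on [t] in [sum_link_cost_le]. *)
Definition link_rate : R := 2 * (2 * entropy_rate d + 57) + 8 * q%:R.

Definition order_rate : R := (8 * 4352 * q%:R ^+ 2 * link_rate)^-1.

Lemma link_rate_ge1 : 1 <= link_rate.
Proof.
have K0 : 0 <= entropy_rate d :> R by [].
by have : 0 <= q%:R :> R by []; rewrite /link_rate; lra.
Qed.

Lemma le_inv_comp (x y z : R) : 0 < x -> 0 < y -> 0 < z -> z <= (x * y)^-1 -> x <= (y * z)^-1.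
Proof.
move=> x0 y0 z0; rewrite invfM ler_pdivlMr// => le.
by rewrite -[x]invrK lef_pV2 ?posrE ?mulr_gt0 ?invr_gt0// mulrC.
Qed.

Hypothesis q0 : (0 < q)%N.

Let qR : 1 <= q%:R :> R. Proof. by rewrite ler1n. Qed.

Let qR0 : 0 < q%:R :> R. Proof. exact: lt_le_trans ltr01 qR. Qed.

Let D0 : 0 < link_rate. Proof. exact: lt_le_trans ltr01 link_rate_ge1. Qed.

Lemma order_rate_gt0 : 0 < order_rate.
Proof. by rewrite invr_gt0 !mulr_gt0 ?exprn_gt0 ?ltr0n. Qed.

Lemma order_rate_field (eps : R) : 0 < eps <= order_rate ->
  let t := (4352 * q%:R ^+ 2 * eps ^+ 2)^-1 in
  link_rate <= t /\ order_rate / eps ^+ 2 <= t / 8.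
Proof.
move=> + t; have := order_rate_gt0; rewrite /order_rate {}/t.
have : 1 <= 4352 :> R by rewrite ler1n.
move: (4352) => C C1 c0 /andP[e0 ec]; have D1 := link_rate_ge1.
have C0 : 0 < C by exact: lt_le_trans ltr01 C1.
have q20 : 0 < q%:R ^+ 2 :> R by rewrite exprn_gt0.
have q21 : 1 <= q%:R ^+ 2 :> R by rewrite exprn_ege1.
have e20 : 0 < eps ^+ 2 by rewrite exprn_gt0.
have ge1 (x y : R) : 1 <= x -> 1 <= y -> 1 <= x * y by move=> *; rewrite mulr_ege1.
have p8 : 1 <= 8 :> R by rewrite ler1n.
have p80 : 0 < 8 :> R by rewrite ltr0n.
split.
  apply: le_inv_comp => //; first by rewrite mulr_gt0.
  apply: (@le_trans _ _ (8 * C * q%:R ^+ 2 * link_rate)^-1).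
    (* The smallness of [eps] passes to [eps ^+ 2], because [order_rate <= 1]. *)
    apply: (@le_trans _ _ (eps * 1)); last by rewrite mulr1.
    rewrite expr2 ler_pM2l//; apply: le_trans ec _.
    by rewrite invf_le1 ?mulr_gt0// !ge1.
  rewrite lef_pV2 ?posrE ?mulr_gt0// [leLHS]mulrC -!mulrA; apply: ler_peMl => //.
  by rewrite ltW// !mulr_gt0.
have -> : (C * q%:R ^+ 2 * eps ^+ 2)^-1 / 8 = (C * q%:R ^+ 2 * 8)^-1 / eps ^+ 2.
  by rewrite [in LHS]invfM [in RHS]invfM mulrAC.
rewrite ler_pM2r ?invr_gt0// lef_pV2 ?posrE ?mulr_gt0// [leLHS]mulrC mulrA; apply: ler_peMr => //.
by rewrite ltW// !mulr_gt0.
Qed.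

Lemma order_rate_temperature (T : R) : 0 < T <= order_rate ->
  let t := (2 * q%:R * T)^-1 in
  [/\ 2 * (entropy_rate d + 2) <= t, 4 * q%:R <= t & order_rate / T <= t / 4].
Proof.
move=> + t; have := order_rate_gt0; rewrite /order_rate {}/t.
have : 1 <= 4352 :> R by rewrite ler1n.
move: (4352) => C C1 c0 /andP[T0 Tc]; set t := (2 * q%:R * T)^-1; have D1 := link_rate_ge1.
have C0 : 0 < C by exact: lt_le_trans ltr01 C1.
have q20 : 0 < q%:R ^+ 2 :> R by rewrite exprn_gt0.
have ge1 (x y : R) : 1 <= x -> 1 <= y -> 1 <= x * y by move=> *; rewrite mulr_ege1.
have p8 : 0 < 8 :> R by rewrite ltr0n.
have K0 : 0 <= entropy_rate d :> R by [].
have Dt : link_rate <= t.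
  apply: le_inv_comp; rewrite ?mulr_gt0//; apply: (le_trans Tc).
  rewrite lef_pV2 ?posrE ?mulr_gt0//.
  rewrite (_ : 8 * C * _ * _ = (4 * C * q%:R) * (link_rate * (2 * q%:R))); last by ring.
  apply: ler_peMl; first by rewrite ltW// !mulr_gt0.
  by rewrite !ge1// ler1n.
have lD : 2 * (entropy_rate d + 2) <= link_rate /\ 4 * q%:R <= link_rate.
  by have := ltW qR0; rewrite /link_rate; move: (q%:R) => x; lra.
split; rewrite ?(le_trans _ Dt)//; try by case: lD.
have -> : t / 4 = (2 * q%:R * 4)^-1 / T.
  by rewrite /t [in LHS]invfM [in RHS]invfM mulrAC.
rewrite ler_pM2r ?invr_gt0// lef_pV2 ?posrE ?mulr_gt0//.
rewrite (_ : 8 * C * _ * _ = (C * q%:R * link_rate) * (2 * q%:R * 4)); last by ring.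
apply: ler_peMl; first by rewrite ltW// !mulr_gt0.
by rewrite !ge1.
Qed.

End Main.

Section LongRangeOrder.
Context {R : realType} {d q N : nat} {dsp} {Om : measurableType dsp}
  (P : probability Om R) (h : 'I_q -> 'rV[int]_d -> {RV P >-> R})
  (iidh : iid_standard_gaussian (fun kv : 'I_q * 'rV[int]_d => h kv.1 kv.2))
  (d3 : (3 <= d)%N) (a : 'I_q).

Local Notation c := (@order_rate R d q).
Local Notation gibbs_a T eps w := (potts_gibbs a T eps (fun k v => h k v w)
  [set s : config d q N | s (origin d N) == a]%SET).

Lemma exp_neg_div_ge0 (x y : R) : 0 <= exp_neg_div x y.
Proof. by rewrite /exp_neg_div; case: ifP => // _; exact: expR_ge0. Qed.

Lemma long_range_order_pos (T eps : R) : 0 < T <= c -> 0 <= eps <= c ->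
  let p : R := 1 - exp_neg_div c T - exp_neg_div c (eps ^+ 2) in
  (p%:E <= P [set w | (p <= gibbs_a T eps w)%R])%E.
Proof.
move=> Tc /andP[eps0 epsc]; cbv zeta; set p := 1 - _ - _; have /andP[T0 _] := Tc.
have q0 : (0 < q)%N := leq_ltn_trans (leq0n a) (ltn_ord a).
have [K1 K2 K3] := order_rate_temperature q0 Tc.
pose i : 'I_d := Ordinal (leq_trans (isT : 0 < 3)%N d3).
pose j : 'I_d := Ordinal (leq_trans (isT : 1 < 3)%N d3).
have ij : i != j by [].
have peierls : 1 - exp_neg_div c T <= 1 - peierls_sum (d := d) (q := q) (N := N) T.
  rewrite lerD2l lerN2 /exp_neg_div gt_eqF//.
  by apply: le_trans; first exact: peierls_sum_le; rewrite ler_expR lerN2.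
have mG : measurable [set w | p <= gibbs_a T eps w].
  by apply: measurable_ge; apply: measurable_gibbs; rewrite gt_eqF.
have pG w : 1 - peierls_sum (d := d) (q := q) (N := N) T <= gibbs_a T eps w ->
    p <= gibbs_a T eps w.
  apply: le_trans; apply: le_trans peierls.
  by rewrite /p lerBlDr lerDl exp_neg_div_ge0.
(* Without a field the estimate holds surely. *)
have [epsE|epsN] := eqVneq eps 0.
  rewrite (_ : [set w | _] = setT) ?probability_setT ?lee_fin.
    by rewrite /p -addrA -opprD lerBlDr lerDl addr_ge0// exp_neg_div_ge0.
  apply/seteqP; split => // w _; apply: pG; rewrite epsE; exact: (gibbs_no_field a d3 ij).
have epsP : 0 < eps by rewrite lt_neqAle eq_sym epsN.
have [E [[mE PE] good]] := chain_event (N := N) iidh a i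
  (max_perimeter (d := d) (N := N)) T0 epsP.
have epsPc : 0 < eps <= c by rewrite epsP.
have [D1 D2] := order_rate_field q0 epsPc.
have PEc : (P E <= (exp_neg_div c (eps ^+ 2))%:E)%E.
  apply: (le_trans PE); rewrite lee_fin /exp_neg_div sqrf_eq0 (negbTE epsN).
  apply: (le_trans (sum_link_cost_le _ _ _)).
  - apply: le_trans _ D1; rewrite /link_rate lerDl mulr_ge0//.
  - apply: le_trans _ D1; rewrite /link_rate lerDr mulr_ge0// addr_ge0// mulr_ge0//.
  by rewrite ler_expR lerN2.
(* Off the exceptional event [E] all chains are bounded, so the Gibbs estimate holds there. *)
apply: (@le_trans _ _ (P (~` E))).
  rewrite probability_setC// EFinB leeB//.
  by rewrite lee_fin lerBlDr lerDl exp_neg_div_ge0.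
apply: le_measure; rewrite ?inE//; first exact: measurableC.
move=> w /good{}good; apply: pG; apply: (gibbs_chain_bounded d3 ij T0) => k m.
exact: good.
Qed.

Lemma long_range_order (T eps : R) : 0 <= T <= c -> 0 <= eps <= c ->
  let p : R := 1 - exp_neg_div c T - exp_neg_div c (eps ^+ 2) in
  (p%:E <= P [set w | (p <= gibbs_a T eps w)%R])%E.
Proof.
move=> /andP[T0 Tc] epsc; cbv zeta; set p := 1 - _ - _.
have [TE|TN] := eqVneq T 0; last first.
  by apply: long_range_order_pos => //; rewrite lt_neqAle eq_sym TN T0.
have c0 : 0 < c by apply: order_rate_gt0; exact: leq_ltn_trans (leq0n a) (ltn_ord a).
(* Positive temperatures [c / n.+1] tending to 0. *)
pose T_ n : R := c * harmonic n.
have T_0 n : 0 < T_ n by rewrite mulr_gt0// harmonic_gt0.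
have T_c n : T_ n <= c by rewrite ler_piMr ?(ltW c0)// invf_le1 ?ltr0n// ler1n.
have T_cvg : T_ n @[n --> \oo] --> (0 : R).
  by rewrite -[0 : R](mulr0 c); apply: cvgM; [exact: cvg_cst|exact: cvg_harmonic].
have exp_cvg : exp_neg_div c (T_ n) @[n --> \oo] --> (0 : R).
  (* Since [c / T_ n = n.+1], the exponential is at most [1 / n.+1]. *)
  apply: (@squeeze_cvgr _ _ _ _ (cst 0) (@harmonic R)).
  - apply: nearW => n; rewrite exp_neg_div_ge0/= /exp_neg_div gt_eqF//.
    rewrite /T_ invfM mulrA divff ?gt_eqF// mul1r invrK expRN.
    rewrite lef_pV2 ?posrE ?expR_gt0 ?ltr0n//.
    by rewrite (le_trans _ (expR_ge1Dx _))// lerDr.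
  - exact: cvg_cst.
  - exact: cvg_harmonic.
apply: (limit_event (g_ := fun n w => gibbs_a (T_ n) eps w)
  (p_ := fun n => 1 - exp_neg_div c (T_ n) - exp_neg_div c (eps ^+ 2))).
- by move=> n; apply: measurable_gibbs; rewrite gt_eqF.
- move=> w; rewrite TE; have /cvg_at_rightP := @cvg_gibbs0 _ _
    (hamiltonian a eps (fun k v => h k v w)) [set s : config d q N | s (origin d N) == a]%SET.
  by move=> /(_ T_); apply; split.
- rewrite (_ : p = 1 - 0 - exp_neg_div c (eps ^+ 2)); last first.
    by rewrite /p TE {1}/exp_neg_div eqxx.
  apply: cvgB; last exact: cvg_cst.
  by apply: cvgB => //; exact: cvg_cst.
- by move=> n; apply: long_range_order_pos => //; rewrite T_0 T_c.
Qed.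

End LongRangeOrder.

Theorem theorem1p3 (R : realType) (d q : nat) (hd : (3 <= d)%N) (hq : (3 <= q)%N) :
  exists2 c : R, 0 < c &
  forall (dsp : measure_display) (Om : measurableType dsp) (P : probability Om R)
    (h : 'I_q -> 'rV[int]_d -> {RV P >-> R}),
    iid_standard_gaussian (fun kv : 'I_q * 'rV[int]_d => h kv.1 kv.2) ->
  forall T eps : R, 0 <= T <= c -> 0 <= eps <= c ->
  forall N : nat, (1 <= N)%N ->
  let p : R := 1 - exp_neg_div c T - exp_neg_div c (eps ^+ 2) in
  (p%:E <= P [set w | p <= potts_gibbs (color1 hq) T eps (fun k v => h k v w)
      [set s : config d q N | s (origin d N) == color1 hq]%SET]%R)%E.
Proof.
exists (order_rate d q); first by apply: order_rate_gt0; exact: ltn_trans hq.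
move=> dsp Om P h iidh T eps Tc epsc N _; exact: long_range_order.
Qed.
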